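(* Let $X\subset\mathbb{R}^n$ be a nonempty orthosymmetric, quadratically convex, convex and compact set and let $\gamma$ be an arbitrary norm on $\mathbb{R}^n$. For any $d\in\mathbb{N}$ and any $k\ge1$, $$\frac{1}{8\sqrt{k\log3}}\Big(1-\frac{d}{k\log3}\Big)\sup_{x\in X,\ \|x\|_0\le d}\big\|\mathrm{res}(x,\gamma)\big\|_2\;\le\;\mathfrak{M}^{\mathsf S}_k(X,\gamma)\;\le\;\mathfrak{M}^{\mathsf R}_k(X,\gamma)\;\le\;\frac{1}{\sqrt k}\sup_{x\in X}\ \sup_{g\in\mathrm{QHull}(B_\gamma)}x^\top g,$$ where $B_\gamma=\{g\in\mathbb{R}^n:\gamma(g)\le1\}$.
   Context: A set $C\subset\mathbb{R}^n$ is orthosymmetric if $x\in C$ and $\sigma\in\{\pm1\}^n$ imply $(\sigma_jx_j)_j\in C$; it is quadratically convex if $C^2=\{(x_j^2)_j: x\in C\}$ is convex. The quadratic hull of $C$ is $\mathrm{QHull}(C)=\{(s_j\sqrt{v_j})_j: v\in\mathrm{Conv}(C^2),\ s\in\{\pm1\}^n\}$ (for orthosymmetric convex $C$, the smallest convex and quadratically convex set containing $C$). $\|x\|_0$ is the number of nonzero entries of $x$; $\mathrm{res}(x,\gamma)=(x_j/\gamma(e_j))_{j=1}^n$ with $e_j$ the standard basis vectors. For a measurable sample space $\mathcal{S}$, $\mathcal{F}^{\gamma,1}$ denotes the functions $F:\mathbb{R}^n\times\mathcal{S}\to\mathbb{R}$, convex in the first argument and measurable in the second, such that $\gamma(g)\le1$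 for all $x\in\mathbb{R}^n$, $s\in\mathcal{S}$, $g\in\partial_xF(x,s)$. For a distribution $P$ on $\mathcal{S}$ with $F(x,\cdot)$ $P$-integrable for all $x$, $f_P(x)=\int F(x,s)\,dP(s)$. The minimax stochastic risk is $$\mathfrak{M}^{\mathsf S}_k(X,\gamma)=\sup_{\mathcal{S}}\inf_{\hat x_k}\sup_{F\in\mathcal{F}^{\gamma,1}}\sup_{P}\ \mathbb{E}\Big[f_P(\hat x_k)-\inf_{x\in X}f_P(x)\Big],$$ where $\hat x_k$ is any $\mathbb{R}^n$-valued rule based on the observed functions $F(\cdot,S_1),\dots,F(\cdot,S_k)$, $S_i$ i.i.d. from $P$ (measurable in the samples for each $F$). The average minimax regret is $$\mathfrak{M}^{\mathsf R}_k(X,\gamma)=\sup_{\mathcal{S}}\inf_{\hat x_{1:k}}\sup_{F\in\mathcal{F}^{\gamma,1},\,s_1^k\in\mathcal{S}^k}\sup_{x\in X}\frac1k\sum_{i=1}^k\big[F(\hat x_i,s_i)-F(x,s_i)\big],$$ where $\hat x_i\in\mathbb{R}^n$ is chosen as a function of $F(\cdot,s_1),\dots,F(\cdot,s_{i-1})$ (measurable in the samples for each $F$). Estimates and plays may lie outside $X$. *)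

(* Defs.v *)
From HB Require Import structures.
From mathcomp Require Import all_boot all_order all_algebra.
From mathcomp Require Import all_classical all_reals all_analysis.

Set Implicit Arguments.
Unset Strict Implicit.
Unset Printing Implicit Defensive.

Import Order.TTheory GRing.Theory Num.Theory.
Import numFieldNormedType.Exports.

Local Open Scope classical_set_scope.
Local Open Scope ring_scope.

Section geometry.
Context {R : realType} {n : nat}.
Implicit Types (x y g v : 'rV[R]_n) (A C X : set 'rV[R]_n).
Implicit Type gamma : 'rV[R]_n -> R.

Definition is_norm gamma :=
  [/\ forall x y, gamma (x + y) <= gamma x + gamma y,
      forall (a : R) x, gamma (a *: x) = `|a| * gamma x
    & forall x, gamma x = 0 -> x = 0].

Definition unit_ball gamma : set 'rV[R]_n := [set g | gamma g <= 1].

Definition dotv x y : R := \sum_(j < n) x ord0 j * y ord0 j.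

Definition l2norm x : R := Num.sqrt (\sum_(j < n) x ord0 j ^+ 2).

Definition l0norm x : nat := #|[pred j | x ord0 j != 0]|.

Definition res x gamma : 'rV[R]_n :=
  \row_j (x ord0 j / gamma (delta_mx ord0 j)).

(* A sign vector in {-1, 1}^n is encoded by booleans: sigma_j = (-1) ^+ s j. *)
Definition flip (s : 'I_n -> bool) x : 'rV[R]_n :=
  \row_j ((-1) ^+ s j * x ord0 j).

Definition orthosymmetric C := forall x s, C x -> C (flip s x).

Definition sqrv x : 'rV[R]_n := \row_j (x ord0 j ^+ 2).

Definition sqrtv v : 'rV[R]_n := \row_j Num.sqrt (v ord0 j).

Definition quadratically_convex C :=
  convex_set (sqrv @` C : set (convex_lmodType 'rV[R]_n)).

Definition Conv A : set 'rV[R]_n :=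
  smallest (@convex_set R 'rV[R]_n) A.

Definition QHull C : set 'rV[R]_n :=
  [set x | exists v s, Conv (sqrv @` C) v /\ x = flip s (sqrtv v)].

Definition subdifferential (f : 'rV[R]_n -> R) x : set 'rV[R]_n :=
  [set g | forall y, f x + dotv g (y - x) <= f y].

End geometry.

Section power_probability.
Context {d : measure_display} {S : measurableType d} {R : realType}.

Definition consp k (p : S * k.-tuple S) : k.+1.-tuple S :=
  [the k.+1.-tuple S of p.1 :: p.2].

Let measurable_consp k : measurable_fun setT (@consp k).
Proof. exact: measurable_cons. Qed.

HB.instance Definition _ k :=
  isMeasurableFun.Build _ _ _ _ (@consp k) (@measurable_consp k).

Variable P : probability S R.

(* The law P^k of k i.i.d. samples from P, on the product sigma-algebra of
   k.-tuple S. *)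
Fixpoint power_prob k : probability (k.-tuple S) R :=
  if k is k'.+1 then distribution (P \x power_prob k')%E (@consp k')
  else dirac [tuple].

Lemma power_prob_box k (A : 'I_k -> set S) :
  (forall i, measurable (A i)) ->
  power_prob k [set t | forall i, A i (tnth t i)] = (\prod_(i < k) P (A i))%E.
Proof.
elim: k A => [|k IH] A mA /=.
  by rewrite big_ord0 diracE mem_set// => -[].
rewrite /distribution/= /pushforward big_ord_recl -IH//.
rewrite -product_measure1E//; last first.
  rewrite [X in measurable X](_ : _ =
      \bigcap_(i in [set: 'I_k]) ((@tnth k S)^~ i @^-1` A (lift ord0 i))).
    apply: fin_bigcap_measurable => // i _; rewrite -[X in measurable X]setTI.
    exact: measurable_tnth.
  by apply/seteqP; split => t /= tA i; [move=> _; exact: tA|exact: tA].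
congr (_ _); apply/seteqP; split => -[x t] /=.
  move=> tA; split; first exact: (tA ord0).
  by move=> i; have := tA (lift ord0 i); rewrite tnthS.
move=> [Ax At] i; have [j ->|->//] := unliftP ord0 i.
by rewrite tnthS; exact: At.
Qed.

End power_probability.

Section minimax.
Context {R : realType} {n : nat}.
Implicit Types (X : set 'rV[R]_n) (gamma : 'rV[R]_n -> R).

(* A rule maps the sequence of observed functions to a point. *)
Definition rule := seq ('rV[R]_n -> R) -> 'rV[R]_n.

Section sample_space.
Context {d : measure_display} (S : measurableType d).
Implicit Types (F : 'rV[R]_n -> S -> R) (P : probability S R) (xhat : rule).

Definition loss_class gamma : set ('rV[R]_n -> S -> R) :=
  [set F | [/\ forall s, convex_function
                 (setT : set (convex_lmodType 'rV[R]_n)) (F^~ s),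
               forall x, measurable_fun setT (F x)
             & forall x s g, subdifferential (F^~ s) x g -> gamma g <= 1]].

Definition observe F (s : seq S) : seq ('rV[R]_n -> R) :=
  [seq F^~ t | t <- s].

(* Borel measurability in R^n is stated coordinatewise. *)
Definition measurable_rule gamma k xhat :=
  forall F, loss_class gamma F -> forall j : 'I_n,
    measurable_fun [set: k.-tuple S] (fun t => xhat (observe F t) ord0 j).

Definition pop_loss P F (x : 'rV[R]_n) : \bar R := (\int[P]_s (F x s)%:E)%E.

Definition admissible_law F : set (probability S R) :=
  [set P | forall x, P.-integrable setT (EFin \o F x)].

(* The integrand is measurable and finite (pop_loss P F is a finite convex
   function, and X is compact in the intended use). If both its positive and
   negative parts have infinite integral, the value is -oo. *)
Definition stoch_risk X k xhat F P : \bar R :=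
  (\int[power_prob P k]_t
    (pop_loss P F (xhat (observe F t)) - ereal_inf (pop_loss P F @` X)))%E.

Definition stoch_minimax_on X gamma k : \bar R :=
  ereal_inf [set ereal_sup [set ereal_sup [set stoch_risk X k xhat F P
                                          | P in admissible_law F]
                           | F in loss_class gamma]
            | xhat in measurable_rule gamma k].

(* The play of round i (counted from 0) is the value of the rule on the i
   previously observed functions; the length of the sequence identifies the
   round. *)
Definition avg_regret k xhat F (s : k.-tuple S) (x : 'rV[R]_n) : R :=
  k%:R^-1 * \sum_(i < k)
    (F (xhat (observe F (take i s))) (tnth s i) - F x (tnth s i)).

Definition regret_minimax_on X gamma k : \bar R :=
  ereal_inf [set ereal_sup [set ereal_sup [set (avg_regret xhat Fs.1 Fs.2 x)%:E
                                          | x in X]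
                           | Fs in loss_class gamma `*` [set: k.-tuple S]]
            | xhat in [set xhat | forall i, (i < k)%N ->
                                    measurable_rule gamma i xhat]].

End sample_space.

(* The suprema range over all (nonempty) measurable spaces. *)
Definition stoch_minimax X gamma k : \bar R :=
  ereal_sup [set m | exists d (S : measurableType d),
                       m = stoch_minimax_on S X gamma k].

Definition regret_minimax X gamma k : \bar R :=
  ereal_sup [set m | exists d (S : measurableType d),
                       m = regret_minimax_on S X gamma k].

End minimax.

(* Main.v *)
Require Import Defs.
From HB Require Import structures.
From mathcomp Require Import all_boot all_order all_algebra.
From mathcomp Require Import all_classical all_reals all_analysis.
From mathcomp Require Import measurable_realfun.
From mathcomp Require Import ring lra.

Set Implicit Arguments.
Unset Strict Implicit.
Unset Printing Implicit Defensive.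

Import Order.TTheory GRing.Theory Num.Theory.
Import numFieldNormedType.Exports.

Local Open Scope classical_set_scope.
Local Open Scope ring_scope.

(** Upper bound on the regret.  Diagonally scaled gradient descent started at 0,
    with step [lam_j] in coordinate [j], has average regret at most
    [sum_j (x_j ^ 2 / (2 * k * lam_j) + lam_j * v_j / 2)] against [x], for an
    average [v] of squared subgradients.  This is linear in [(x ^ 2, v)], which
    ranges over the convex set [X ^ 2 * Conv (B ^ 2)]; the best weights for the
    worst pair give [sum_j |x_j| * sqrt v_j / sqrt k], that is, [x^T g / sqrt k]
    with [g] in the quadratic hull of the unit ball [B].  Exchanging the infimum over
    the weights and the supremum over the pairs is done by hand in
    [near_optimal_weights]: weights read off a near-maximiser of the concave
    function [sum_j sqrt (u_j * v_j)] are near-optimal, by its first-order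
    optimality condition.  A rule has to be measurable in the samples, so that
    subgradients have to be selected measurably ([measurable_subgrad]); taking
    directional derivatives one coordinate axis after the other selects one by
    countable infima.

    From regret to risk.  Playing the average of the iterates of a low-regret rule
    on an i.i.d. sample has risk at most the average regret, by convexity and
    because the [i]-th play is independent of the [i]-th sample.  As the plays may
    be unbounded, their losses may fail to be integrable; [integral_regret_le]
    integrates the pointwise regret bound one sample at a time and only ever needs
    one-sided bounds.

    Lower bound on the risk.  For [x] in [X] the corners [(+-|x_j|)_j] all lie in
    [X].  A sample shows a coordinate [j], drawn with probability [p_j], and a
    sign of bias [delta_j] towards the [j]-th sign of a hidden corner; the loss is
    the distance to the shown sign times [|x_j|], divided by [gamma e_j].  A point
    on the wrong side in coordinate [j] has excess loss at least
    [p_j * delta_j * |x_j| / gamma e_j] ([coin_gap]).  If [k * p_j * delta_j ^ 2]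
    is at most [1 / (4 * ln 3)], then the two signs of coordinate [j] cannot be
    told apart from [k] samples ([two_point_test]), whence an error probability
    of at least 1/4 on average over the corners.  With [p_j] proportional to the
    square of the [j]-th entry of [res x gamma] and [delta_j] as large as
    possible, the bound follows ([stoch_minimax_ge_res]). *)

(** * Subgradients by iterated directional derivatives *)

Section infimum.
Context {R : realType}.

Lemma inf_range_le (u : nat -> R) b m :
  (forall i, b <= u i) -> inf (range u) <= u m.
Proof.
by move=> bu; apply: ge_inf; [exists b => _ [i _ <-]; exact: bu|exists m].
Qed.

Lemma inf_range_ge (u : nat -> R) b :
  (forall i, b <= u i) -> b <= inf (range u).
Proof.
by move=> bu; apply: lb_le_inf; [exists (u 0%N), 0%N|move=> _ [i _ <-]].
Qed.

Lemma natr_ge_ex (x : R) : exists m : nat, x <= m%:R.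
Proof.
exists (Num.truncn `|x|).+1.
by rewrite (le_trans (ler_norm _))// ltW// truncnS_gt.
Qed.

End infimum.

Section sublinear.
Context {R : realType} {V : lmodType R}.
Implicit Types (f h : V -> R) (x v w e : V).

Definition convex_fun f := forall x y (s t : R),
  0 <= s -> 0 <= t -> s + t = 1 -> f (s *: x + t *: y) <= s * f x + t * f y.

Definition sublinear h :=
  (forall v w, h (v + w) <= h v + h w) /\
  (forall (c : R) v, 0 <= c -> h (c *: v) = c * h v).

Lemma convex_functionP f :
  convex_function (setT : set (convex_lmodType V)) f <-> convex_fun f.
Proof.
split=> [cf x y s t s0 t0 st1|cf t x y _ _].
  have s1 : s <= 1 by rewrite -st1 lerDl.
  have -> : t = 1 - s by lra.
  by apply: (cf (Itv01 s0 s1) x y); rewrite in_setT.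
apply: (cf x y t%:num (1 - t%:num)) => //.
by rewrite addrC subrK.
Qed.

Lemma sublinear0 h : sublinear h -> h 0 = 0.
Proof. by move=> [_ hZ]; rewrite -(scale0r 0) hZ// mul0r. Qed.

Lemma sublinear_ge h v : sublinear h -> - h (- v) <= h v.
Proof.
by move=> sh; have := sh.1 (- v) v; rewrite addNr sublinear0//; lra.
Qed.

Definition quotient f x v (t : R) := (f (x + t *: v) - f x) / t.

(** An infimum over a sequence of steps, rather than over all positive steps, so
    that it inherits measurability from [f]. *)
Definition dirder f x v : R :=
  inf (range (fun m : nat => quotient f x v m.+1%:R^-1)).

Lemma quotient_ge f x v (t : R) : convex_fun f -> 0 < t ->
  f x - f (x - v) <= quotient f x v t.
Proof.
move=> cf t0; rewrite /quotient ler_pdivlMr//.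
have t1 : 0 < 1 + t by rewrite addr_gt0.
have a0 : 0 <= (1 + t)^-1 by rewrite invr_ge0 ltW.
have b0 : 0 <= t / (1 + t) by rewrite divr_ge0// ltW.
have := cf (x + t *: v) (x - v) _ _ a0 b0.
have -> : (1 + t)^-1 + t / (1 + t) = 1 by field; lra.
have -> : (1 + t)^-1 *: (x + t *: v) + (t / (1 + t)) *: (x - v) = x.
  rewrite !scalerDr scalerN scalerA addrACA [_^-1 * t]mulrC subrr addr0.
  by rewrite -scalerDl -[X in _ = X]scale1r; congr (_ *: _); field; lra.
move=> /(_ erefl); rewrite -(ler_pM2r t1).
have -> : ((1 + t)^-1 * f (x + t *: v) + t / (1 + t) * f (x - v)) * (1 + t) =
   f (x + t *: v) + t * f (x - v) by field; lra.
by lra.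
Qed.

Lemma quotient_mono f x v (s t : R) : convex_fun f -> 0 < s -> s <= t ->
  quotient f x v s <= quotient f x v t.
Proof.
move=> cf s0 st; have t0 := lt_le_trans s0 st.
rewrite /quotient ler_pdivrMr//.
have a0 : 0 <= s / t by rewrite divr_ge0// ltW.
have b0 : 0 <= 1 - s / t by rewrite subr_ge0 ler_pdivrMr// mul1r.
have := cf (x + t *: v) x _ _ a0 b0; rewrite subrKC => /(_ erefl).
have -> : (s / t) *: (x + t *: v) + (1 - s / t) *: x = x + s *: v.
  rewrite scalerDr scalerA divfK ?gt_eqF// scalerBl scale1r.
  by rewrite addrC addrA subrK.
move=> h; rewrite (_ : _ * s = s / t * f (x + t *: v) + (1 - s / t) * f x - f x).
  by rewrite lerD2r.
by field; lra.
Qed.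

Lemma dirder_le f x v (t : R) : convex_fun f -> 0 < t ->
  dirder f x v <= quotient f x v t.
Proof.
move=> cf t0; have [m tm] := natr_ge_ex t^-1.
have mt : m.+1%:R^-1 <= t.
  rewrite -[leRHS]invrK lef_pV2 ?posrE ?invr_gt0//.
  by rewrite (le_trans tm)// ler_nat.
apply: le_trans (quotient_mono x v cf _ mt); rewrite ?invr_gt0//.
by apply: inf_range_le => i; apply: quotient_ge; rewrite ?invr_gt0.
Qed.

Lemma dirder_ge f x v b : (forall t, 0 < t -> b <= quotient f x v t) ->
  b <= dirder f x v.
Proof. by move=> h; apply: inf_range_ge => i; rewrite h// invr_gt0. Qed.

Lemma dirder_sublinear f x : convex_fun f -> sublinear (dirder f x).
Proof.
move=> cf.
have hom c v : 0 < c -> c * dirder f x v <= dirder f x (c *: v).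
  move=> c0; apply: dirder_ge => t t0.
  rewrite (_ : quotient _ _ _ _ = c * quotient f x v (t * c)).
    by rewrite ler_pM2l// dirder_le// mulr_gt0.
  by rewrite /quotient scalerA; field; rewrite !gt_eqF.
split=> [v w|c v].
  rewrite -lerBlDr; apply: dirder_ge => s s0.
  rewrite lerBlDl -lerBlDr; apply: dirder_ge => t t0; rewrite lerBlDl.
  have st0 : 0 < s + t by rewrite addr_gt0.
  have p0 : 0 < s * t / (s + t) by rewrite divr_gt0// mulr_gt0.
  rewrite (le_trans (dirder_le x (v + w) cf p0))// /quotient ler_pdivrMr//.
  have a0 : 0 <= t / (s + t) by rewrite divr_ge0// ltW.
  have b0 : 0 <= s / (s + t) by rewrite divr_ge0// ltW.
  have E : t / (s + t) + s / (s + t) = 1 by field; lra.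
  have H := cf (x + s *: v) (x + t *: w) _ _ a0 b0 E; rewrite lerBlDr.
  have -> : x + (s * t / (s + t)) *: (v + w) =
     (t / (s + t)) *: (x + s *: v) + (s / (s + t)) *: (x + t *: w).
    rewrite !scalerDr !scalerA addrACA -scalerDl E scale1r.
    by rewrite [t / _ * _]mulrAC [t * s]mulrC [s / _ * _]mulrAC.
  apply: (le_trans H); rewrite le_eqVlt; apply/orP; left; apply/eqP.
  by field; rewrite !gt_eqF.
rewrite le_eqVlt => /predU1P[<-|c0].
  rewrite scale0r mul0r; apply/eqP; rewrite eq_le; apply/andP; split.
    rewrite (le_trans (dirder_le x 0 cf (ltr01 : 0 < 1 :> R)))//.
    by rewrite /quotient scaler0 addr0 subrr mul0r.
  by apply: dirder_ge => t t0; rewrite /quotient scaler0 addr0 subrr mul0r.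
apply/eqP; rewrite eq_le hom// andbT.
rewrite -ler_pdivrMl//; apply: le_trans (hom _ _ _) _; rewrite ?invr_gt0//.
by rewrite scalerA mulVf ?gt_eqF// scale1r.
Qed.

(** The directional derivative of a sublinear [h] at [e] in the direction [v]:
    by homogeneity, the quotient with step [1 / m] is this difference. *)
Definition lexstep h e v : R :=
  inf (range (fun m : nat => h (v + m%:R *: e) - m%:R * h e)).

Lemma lexstep_bound h e v (t : R) : sublinear h -> 0 <= t ->
  - h (- v) <= h (v + t *: e) - t * h e.
Proof.
move=> sh t0; have := sh.1 (v + t *: e) (- v).
by rewrite addrAC subrr add0r sh.2//; lra.
Qed.

Lemma lexstep_le h e v (m : nat) : sublinear h ->
  lexstep h e v <= h (v + m%:R *: e) - m%:R * h e.
Proof.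
move=> sh.
apply: (inf_range_le (u := fun m : nat => h (v + m%:R *: e) - m%:R * h e)).
by move=> i; apply: lexstep_bound.
Qed.

Lemma lexstep_leW h e v : sublinear h -> lexstep h e v <= h v.
Proof.
by move=> /(lexstep_le e v 0)/le_trans->//; rewrite scale0r addr0 mul0r subr0.
Qed.

Lemma lexstep_sublinear h e : sublinear h -> sublinear (lexstep h e).
Proof.
move=> sh.
have lexle v (t : R) : 0 <= t -> lexstep h e v <= h (v + t *: e) - t * h e.
  move=> t0; have [m tm] := natr_ge_ex t.
  apply: (le_trans (lexstep_le e v m sh)).
  have := sh.1 (v + t *: e) ((m%:R - t) *: e).
  by rewrite -addrA -scalerDl addrCA subrr addr0 (sh.2 (_ - _)) ?subr_ge0//; lra.
have hom c v : 0 < c -> c * lexstep h e v <= lexstep h e (c *: v).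
  move=> c0; apply: inf_range_ge => m.
  have -> : c *: v + m%:R *: e = c *: (v + (m%:R / c) *: e).
    by rewrite scalerDr scalerA [c * _]mulrC divfK ?gt_eqF.
  rewrite (sh.2 _ _ (ltW c0)).
  have mc0 : 0 <= m%:R / c by rewrite divr_ge0// ltW.
  have := lexle v _ mc0; rewrite -(ler_pM2l c0) => /le_trans; apply.
  by rewrite le_eqVlt; apply/orP; left; apply/eqP; field; rewrite gt_eqF.
split=> [v w|c v].
  rewrite -lerBlDr; apply: inf_range_ge => i.
  rewrite lerBlDl -lerBlDr; apply: inf_range_ge => j.
  rewrite lerBlDl; apply: (le_trans (lexstep_le e (v + w) (i + j) sh)).
  have := sh.1 (v + i%:R *: e) (w + j%:R *: e).
  by rewrite addrACA -scalerDl -natrD natrD; lra.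
rewrite le_eqVlt => /predU1P[<-|c0].
  rewrite scale0r mul0r; apply/eqP; rewrite eq_le; apply/andP; split.
    by rewrite (le_trans (lexstep_leW e 0 sh))// sublinear0.
  by apply: inf_range_ge => m; rewrite add0r sh.2// subrr.
apply/eqP; rewrite eq_le hom// andbT.
rewrite -ler_pdivrMl//; apply: le_trans (hom _ _ _) _; rewrite ?invr_gt0//.
by rewrite scalerA mulVf ?gt_eqF// scale1r.
Qed.

Lemma lexstepN h e : sublinear h -> lexstep h e (- e) <= - h e.
Proof.
move=> sh; apply: (le_trans (lexstep_le e (- e) 1 sh)).
by rewrite scale1r addNr sublinear0// mul1r add0r.
Qed.

End sublinear.

Section subgradient.
Context {R : realType} {n : nat}.
Implicit Types (f : 'rV[R]_n -> R) (x v : 'rV[R]_n).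

Let E (j : nat) : 'rV[R]_n := \row_i (i == j :> nat)%:R.

(** Differentiating once more at a coordinate axis makes the derivative linear
    along that axis, keeps it linear along the earlier ones, and can only
    decrease it.  After [n] steps it is a linear functional below the directional
    derivative of [f]. *)
Fixpoint lexder f x (j : nat) : 'rV[R]_n -> R :=
  if j is j'.+1 then lexstep (lexder f x j') (E j') else dirder f x.

Definition subgrad f x : 'rV[R]_n := \row_(j < n) lexder f x j (E j).

Lemma lexder_sublinear f x j : convex_fun f -> sublinear (lexder f x j).
Proof.
by move=> cf; elim: j => [|j]; [exact: dirder_sublinear|exact: lexstep_sublinear].
Qed.

Lemma lexder_mono f x i j v : convex_fun f -> (i <= j)%N ->
  lexder f x j v <= lexder f x i v.
Proof.
move=> cf; elim: j => [|j IH]; first by rewrite leqn0 => /eqP ->.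
rewrite leq_eqVlt => /predU1P[->//|/IH]; apply: le_trans.
exact/lexstep_leW/lexder_sublinear.
Qed.

Lemma lexder_axis f x (i : 'I_n) (c : R) : convex_fun f ->
  lexder f x n (c *: E i) <= c * lexder f x i (E i).
Proof.
move=> cf; have sn := lexder_sublinear x n cf.
have [c0|c0] := leP 0 c.
  by rewrite sn.2// ler_wpM2l// lexder_mono// ltnW.
have -> : c *: E i = (- c) *: (- E i) by rewrite scaleNr scalerN opprK.
rewrite sn.2; last by rewrite oppr_ge0 ltW.
rewrite -[leRHS]mulrNN ler_wpM2l ?oppr_ge0 ?(ltW c0)//.
apply: le_trans (lexder_mono x _ cf (ltn_ord i)) _.
exact/lexstepN/lexder_sublinear.
Qed.

(** Sublinearity bounds [lexder f x n] from above by its values along the axes,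
    hence also from below, by applying the bound to [- v]. *)
Lemma subgrad_lexder f x v : convex_fun f ->
  dotv (subgrad f x) v <= lexder f x n v.
Proof.
move=> cf; have sn := lexder_sublinear x n cf.
have sub_sum (F : 'I_n -> 'rV[R]_n) :
    lexder f x n (\sum_i F i) <= \sum_i lexder f x n (F i).
  elim/big_ind2: _ => [|u a w b ua wb|//]; first by rewrite sublinear0.
  by rewrite (le_trans (sn.1 _ _))// lerD.
have le_dot w : lexder f x n w <= dotv (subgrad f x) w.
  have {1}-> : w = \sum_(i < n) w ord0 i *: E i.
    apply/rowP => k; rewrite summxE (bigD1 k)//= !mxE eqxx mulr1 big1 ?addr0//.
    by move=> i ik; rewrite !mxE val_eqE eq_sym (negbTE ik) mulr0.
  apply: (le_trans (sub_sum _)); apply: ler_sum => i _.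
  by rewrite mxE mulrC; exact: lexder_axis.
have := sublinear_ge v sn; apply: le_trans; rewrite lerNr.
apply: (le_trans (le_dot _)); rewrite /dotv -sumrN; apply: ler_sum => i _.
by rewrite !mxE mulrN.
Qed.

Lemma subgradP f x : convex_fun f -> subdifferential f x (subgrad f x).
Proof.
move=> cf y /=; rewrite -lerBrDl; apply: (le_trans (subgrad_lexder x _ cf)).
apply: (le_trans (lexder_mono x _ cf (leq0n n))).
have := dirder_le x (y - x) cf (ltr01 : 0 < 1 :> R).
by rewrite /quotient scale1r divr1 subrKC.
Qed.

Lemma subgrad_le f x y : convex_fun f -> f x - f y <= dotv (subgrad f x) (x - y).
Proof.
move=> cf; have := subgradP x cf y.
have -> : dotv (subgrad f x) (y - x) = - dotv (subgrad f x) (x - y).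
  by rewrite /dotv -sumrN; apply: eq_bigr => j _; rewrite !mxE; ring.
lra.
Qed.

End subgradient.
(** * Lipschitz losses and joint measurability *)

Section measurable_infimum.
Context d (T : measurableType d) (R : realType).

Lemma measurable_inf_range (u : nat -> T -> R) (b : T -> R) :
  (forall m t, b t <= u m t) -> (forall m, measurable_fun setT (u m)) ->
  measurable_fun setT (fun t => inf (range (u^~ t))).
Proof.
move=> bu mu; rewrite (_ : (fun t => _) = (fun t => infs (u^~ t) 0%N)).
  by apply: measurable_fun_infs => // t _; exists (b t) => _ [m _ <-]; exact: bu.
apply/funext => t; rewrite /infs /sdrop; congr inf.
by apply/seteqP; split => [_ [m _ <-]|_ [m _ <-]]; exists m.
Qed.

End measurable_infimum.

Section norm_facts.
Context {R : realType} {n : nat}.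
Implicit Types (x y g : 'rV[R]_n) (gamma : 'rV[R]_n -> R).

Definition l1norm x : R := \sum_(j < n) `|x ord0 j|.

Variable gamma : 'rV[R]_n -> R.
Hypothesis gamma_norm : is_norm gamma.

Lemma is_norm0 : gamma 0 = 0.
Proof. by case: gamma_norm => _ gZ _; rewrite -(scale0r 0) gZ normr0 mul0r. Qed.

Lemma is_normN x : gamma (- x) = gamma x.
Proof. by case: gamma_norm => _ gZ _; rewrite -scaleN1r gZ normrN1 mul1r. Qed.

Lemma is_norm_ge0 x : 0 <= gamma x.
Proof.
case: gamma_norm => gD _ _.
by have := gD x (- x); rewrite subrr is_norm0 is_normN; lra.
Qed.

Lemma is_norm_delta_gt0 (j : 'I_n) : 0 < gamma (delta_mx ord0 j).
Proof.
rewrite lt_neqAle is_norm_ge0 andbT eq_sym; apply/eqP.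
case: gamma_norm => _ _ /[apply] /rowP/(_ j)/eqP.
by rewrite !mxE !eqxx/= oner_eq0.
Qed.

Lemma is_norm_le_l1 x :
  gamma x <= (\sum_(j < n) gamma (delta_mx ord0 j)) * l1norm x.
Proof.
case: gamma_norm => gD gZ _.
rewrite {1}[x]row_sum_delta mulr_sumr.
have gsum (F : 'I_n -> 'rV[R]_n) : gamma (\sum_j F j) <= \sum_j gamma (F j).
  elim/big_ind2: _ => [|u a w b ua wb|//]; first by rewrite is_norm0.
  by rewrite (le_trans (gD _ _))// lerD.
apply: (le_trans (gsum _)); apply: ler_sum => j _.
rewrite gZ mulrC ler_wpM2r// (bigD1 j)//= lerDl sumr_ge0// => i _.
exact: is_norm_ge0.
Qed.

Lemma coord_le_norm x (j : 'I_n) : `|x ord0 j| <= `|x|.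
Proof.
have -> : `|x| = mx_norm x by [].
rewrite mx_normrE; apply/bigmax_geP; right => /=.
by exists (ord0, j).
Qed.

Lemma is_norm_continuous : continuous (gamma : 'rV[R]_n -> R).
Proof.
case: (gamma_norm) => gD gZ _ x.
apply/(@cvgrPdist_le _ _ _ (nbhs x) (nbhs_filter x)) => /= e e0.
pose C := \sum_(j < n) gamma (delta_mx ord0 j).
have C0 : 0 <= C by apply: sumr_ge0 => j _; exact: is_norm_ge0.
have gB u v : gamma u - gamma v <= gamma (u - v).
  by have := gD (u - v) v; rewrite subrK; lra.
have D0 : 0 < C * n%:R + 1 by rewrite ltr_wpDl// mulr_ge0.
apply/nbhs_ballP; exists (e / (C * n%:R + 1)) => [|y xy] /=.
  by rewrite divr_gt0.
have : gamma (x - y) <= e.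
  apply: (le_trans (is_norm_le_l1 _)); rewrite -/C.
  have l1 : l1norm (x - y) <= n%:R * (e / (C * n%:R + 1)).
    rewrite mulr_natl -[X in _ *+ X]card_ord -sumr_const.
    by apply: ler_sum => j _; rewrite !mxE ltW//; exact: (xy.2 ord0 j).
  rewrite (le_trans (ler_wpM2l C0 l1))// !mulrA ler_pdivrMr//; lra.
have := gB x y; have := gB y x.
rewrite -[y - x]opprB is_normN ler_norml; lra.
Qed.

(** Norm equivalence: [gamma] attains a positive minimum on the unit sphere. *)
Lemma unit_ball_bounded : exists2 C : R, 0 <= C &
  forall g, unit_ball gamma g -> forall j, `|g ord0 j| <= C.
Proof.
pose sphere := [set x : 'rV[R]_n | `|x| = 1].
have [[x0 sx0]|noS] := pselect (sphere !=set0); last first.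
  exists 0 => // g _ j; have [->|g0] := eqVneq g 0; first by rewrite mxE normr0.
  exfalso; apply: noS; exists (`|g|^-1 *: g).
  by rewrite /sphere/= normrZ normfV normr_id mulVf ?normr_eq0.
have [] := @EVT_min_rV R n gamma sphere.
- by exists x0.
- apply: bounded_closed_compact.
    exists 1; split => // e e1 x /= ->; exact: ltW.
  have := @closed_comp _ _ (fun x : 'rV[R]_n => `|x|) [set 1 : R].
  apply => //; move=> x _. exact: norm_continuous.
- exact/continuous_subspaceT/is_norm_continuous.
move=> c [sc cmin].
have c0 : 0 < gamma c.
  rewrite lt_neqAle is_norm_ge0 andbT eq_sym; apply/eqP.
  case: gamma_norm => _ _ /[apply] c00; move: sc; rewrite inE /sphere/= c00 normr0.
  by move/eqP; rewrite eq_sym oner_eq0.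
exists (gamma c)^-1; first by rewrite invr_ge0 ltW.
move=> g g1 j; apply: (le_trans (coord_le_norm _ _)).
have [->|g0] := eqVneq g 0; first by rewrite normr0 invr_ge0 ltW.
have gp : 0 < `|g| by rewrite normr_gt0.
have := cmin (`|g|^-1 *: g); rewrite inE /sphere/= normrZ normfV normr_id.
rewrite mulVf ?normr_eq0// => /(_ erefl).
case: gamma_norm => _ -> _; rewrite normfV normr_id => h.
rewrite -[leRHS]mul1r ler_pdivlMr// mulrC -ler_pdivlMr//.
by apply: (le_trans h); rewrite mulrC ler_wpM2r// invr_ge0.
Qed.

End norm_facts.
Section lipschitz.
Context {R : realType} {n : nat}.
Implicit Types (f : 'rV[R]_n -> R) (x y z g v : 'rV[R]_n).

Definition l1_lipschitz (L : R) f :=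
  forall x y, f x - f y <= L * l1norm (x - y).

Lemma dotv_le_l1 (C : R) g x : (forall j, `|g ord0 j| <= C) ->
  dotv g x <= C * l1norm x.
Proof.
move=> gC; rewrite mulr_sumr; apply: ler_sum => j _.
by rewrite (le_trans (ler_norm _))// normrM ler_wpM2r.
Qed.

Lemma loss_class_convex d (S : measurableType d) gamma (F : 'rV[R]_n -> S -> R) s :
  loss_class gamma F -> convex_fun (F^~ s).
Proof. by move=> [cF _ _]; exact/convex_functionP/cF. Qed.

Lemma loss_class_subgrad d (S : measurableType d) gamma
    (F : 'rV[R]_n -> S -> R) s x :
  loss_class gamma F -> unit_ball gamma (subgrad (F^~ s) x).
Proof.
by move=> lF; case: (lF) => _ _; apply; exact/subgradP/loss_class_convex/lF.
Qed.

(** One constant serves all losses and all samples, because the subgradients lie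
    in the unit ball of [gamma]. *)
Lemma loss_class_lipschitz gamma : is_norm gamma ->
  exists2 L : R, 0 <= L & forall d (S : measurableType d)
    (F : 'rV[R]_n -> S -> R), loss_class gamma F -> forall s, l1_lipschitz L (F^~ s).
Proof.
move=> /unit_ball_bounded[C C0 gC]; exists C => // d S F lF s x y.
apply: (le_trans (subgrad_le x y (loss_class_convex s lF))).
exact/dotv_le_l1/gC/loss_class_subgrad.
Qed.

Lemma rat_dense_l1 x (e : R) : 0 < e ->
  exists q : 'rV[rat]_n, l1norm (map_mx ratr q - x) < e.
Proof.
move=> e0; pose a := e / n.+1%:R.
have a0 : 0 < a by rewrite divr_gt0.
have /choice[q qP] (j : 'I_n) : exists q : rat, `|ratr q - x ord0 j| <= a.
  have [|q] := @rat_in_itvoo R (x ord0 j) (x ord0 j + a); first by rewrite ltrDl.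
  by rewrite in_itv/= => qP; exists q; rewrite ler_norml; lra.
exists (\row_j q j); apply: (@le_lt_trans _ _ (\sum_(j < n) a)).
  by apply: ler_sum => j _; rewrite !mxE.
rewrite sumr_const card_ord -mulr_natr -mulrA gtr_pMr//.
by rewrite mulrC ltr_pdivrMr// mul1r ltr_nat.
Qed.

(** An [L]-Lipschitz function is the infimum of its Lipschitz upper bounds
    [F q + L * l1norm (q - y)] over the countably many rational points [q].
    This reduces measurability at a moving point to fixed points. *)
Lemma measurable_lipschitz_comp d (T : measurableType d) (F : 'rV[R]_n -> T -> R)
    (L : R) (y : T -> 'rV[R]_n) : 0 <= L ->
  (forall x, measurable_fun setT (F x)) ->
  (forall t, l1_lipschitz L (F^~ t)) ->
  (forall j, measurable_fun setT (fun t => y t ord0 j)) ->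
  measurable_fun setT (fun t => F (y t) t).
Proof.
move=> L0 mF LF my.
pose q m : 'rV[R]_n := map_mx ratr (odflt 0 (unpickle m : option 'rV[rat]_n)).
pose u m t := F (q m) t + L * l1norm (q m - y t).
have u_ge m t : F (y t) t <= u m t.
  rewrite /u -lerBlDl (le_trans (LF t _ _))// /l1norm.
  under eq_bigr do rewrite !mxE distrC.
  by under [X in _ <= _ * X]eq_bigr do rewrite !mxE.
rewrite (_ : (fun t => _) = (fun t => inf (range (u^~ t)))).
  apply: (measurable_inf_range (b := fun t => F (y t) t)) => // m.
  apply: measurable_funD => //; apply: measurable_funM => //.
  apply: measurable_sum => j; apply: measurableT_comp => //.
  under eq_fun do rewrite !mxE.
  exact: measurable_funB.
apply/funext => t; apply/eqP; rewrite eq_le; apply/andP; split.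
  by apply: inf_range_ge => m; exact: u_ge.
apply/ler_addgt0Pr => e e0.
have [p pe] := rat_dense_l1 (y t) (divr_gt0 e0 (ltr_wpDl L0 (ltr_wpDl L0 ltr01))).
apply: (le_trans (inf_range_le (pickle p) (u_ge^~ t))).
rewrite /u (_ : q _ = map_mx ratr p); last by rewrite /q pickleK.
have := LF t (map_mx ratr p) (y t).
have : L * l1norm (map_mx ratr p - y t) <= L * (e / (L + (L + 1))).
  by rewrite ler_wpM2l// ltW.
have : (L + L) * (e / (L + (L + 1))) <= e.
  rewrite mulrA ler_pdivrMr; first by rewrite mulrC ler_pM2l//; lra.
  lra.
rewrite mulrDl; lra.
Qed.

Lemma measurable_subgrad d (T : measurableType d) (F : 'rV[R]_n -> T -> R)
    (L : R) (y : T -> 'rV[R]_n) : 0 <= L ->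
  (forall t, convex_fun (F^~ t)) ->
  (forall x, measurable_fun setT (F x)) ->
  (forall t, l1_lipschitz L (F^~ t)) ->
  (forall j, measurable_fun setT (fun t => y t ord0 j)) ->
  forall j, measurable_fun setT (fun t => subgrad (F^~ t) (y t) ord0 j).
Proof.
move=> L0 cF mF LF my j.
suff mlex i v : measurable_fun setT (fun t => lexder (F^~ t) (y t) i v).
  under eq_fun do rewrite mxE.
  exact: mlex.
elim: i v => [|i IH] v /=.
  apply: (measurable_inf_range (b := fun t => F (y t) t - F (y t - v) t)).
    by move=> m t; apply: quotient_ge => //; rewrite invr_gt0.
  move=> m; apply: measurable_funM => //; apply: measurable_funB.
    apply: (measurable_lipschitz_comp L0) => // k.
    under eq_fun do rewrite !mxE.
    exact: measurable_funD.
  exact: (measurable_lipschitz_comp L0).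
apply: (measurable_inf_range (b := fun t => - lexder (F^~ t) (y t) i (- v))).
  by move=> m t; apply: lexstep_bound => //; exact: lexder_sublinear.
by move=> m; apply: measurable_funB => //; apply: measurable_funM.
Qed.

End lipschitz.
(** * Near-optimal diagonal weights *)

Section scaling.
Context {R : realType} {n : nat}.
Implicit Types (u v : 'rV[R]_n) (U V : set 'rV[R]_n).

Lemma convex_set_segment U u v (t : R) :
  convex_set (U : set (convex_lmodType 'rV[R]_n)) -> U u -> U v ->
  0 <= t -> t <= 1 -> U (t *: u + (1 - t) *: v).
Proof.
by move=> cU Uu Uv t0 t1; apply/set_mem; apply: (cU u v (Itv01 t0 t1)); apply/mem_set.
Qed.

(** The left-hand side is the harmonic mean of [A] and [B], in a form that shows
    it to agree with the arithmetic mean up to second order. *)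
Lemma geometric_mean_expansion (A B : R) : 0 < A -> 0 < B ->
  (A + B) / 2 - (A - B) ^+ 2 / (2 * (A + B)) <= Num.sqrt (A * B).
Proof.
move=> A0 B0; have AB0 := mulr_gt0 A0 B0; have sAB := addr_gt0 A0 B0.
have -> : (A + B) / 2 - (A - B) ^+ 2 / (2 * (A + B)) = 2 * (A * B) / (A + B).
  by field; rewrite gt_eqF.
rewrite ler_pdivrMr// -{1}[A * B]sqr_sqrtr ?(ltW AB0)// expr2 mulrA [leLHS]mulrC.
rewrite ler_pM2l ?sqrtr_gt0// -[leRHS]ger0_norm ?(ltW sAB)// -sqrtr_sqr.
rewrite -[X in X * _]ger0_norm// -sqrtr_sqr -sqrtrM ?sqr_ge0// ler_sqrt ?sqr_ge0//.
have := sqr_ge0 (A - B); lra.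
Qed.

(** The first-order optimality condition at a maximiser [(a, b)] of the
    concave function [sum_j sqrt (u_j * v_j)] says that the weights
    [mu_j = sqrt (a_j / b_j)] make the linear majorant
    [sum_j (u_j / mu_j + mu_j * v_j) / 2] maximal at [(a, b)] too.  Shifting all
    coordinates by [eps] keeps the weights finite and the function smooth, and
    then an approximate maximiser is enough. *)
Lemma near_optimal_weights U V (M B e : R) :
  0 <= M -> U !=set0 -> V !=set0 ->
  convex_set (U : set (convex_lmodType 'rV[R]_n)) ->
  convex_set (V : set (convex_lmodType 'rV[R]_n)) ->
  (forall u j, U u -> 0 <= u ord0 j <= M) ->
  (forall v j, V v -> 0 <= v ord0 j <= M) ->
  (forall u v, U u -> V v -> \sum_j Num.sqrt (u ord0 j * v ord0 j) <= B) ->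
  0 < e ->
  exists2 mu : 'I_n -> R, forall j, 0 < mu j &
    forall u v, U u -> V v ->
      \sum_(j < n) (u ord0 j / mu j + mu j * v ord0 j) / 2 <= B + e.
Proof.
move=> M0 [u0 Uu0] [v0 Vv0] cU cV UM VM UVB e0.
(* The shift [eps] raises each square root by at most [eta], hence the sum of the
   [n] roots by at most [e / 3]. *)
pose eta := e / (3 * n.+1%:R).
have eta0 : 0 < eta by rewrite divr_gt0// mulr_gt0.
pose eps := Num.min 1 (eta ^+ 2 / (2 * M + 1)).
have M1 : 0 < 2 * M + 1 by lra.
have eps0 : 0 < eps by rewrite lt_min ltr01 divr_gt0// exprn_gt0.
have eps1 : eps <= 1 by rewrite ge_min lexx.
have epsM : eps * (2 * M + 1) <= eta ^+ 2.
  by rewrite -ler_pdivlMr// ge_min lexx orbT.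
pose psi (w : 'rV[R]_n * 'rV[R]_n) :=
  \sum_j Num.sqrt ((w.1 ord0 j + eps) * (w.2 ord0 j + eps)).
have psiB u v : U u -> V v -> psi (u, v) <= B + e / 3.
  move=> Uu Vv; have sumeta : \sum_(j < n) eta <= e / 3.
    rewrite sumr_const card_ord -[eta *+ _]mulr_natl.
    have -> : e / 3 = n.+1%:R * eta by rewrite /eta; field; have := ler0n R n; lra.
    by rewrite ler_pM2r// ler_nat.
  rewrite (le_trans _ (lerD (UVB _ _ Uu Vv) sumeta))// -big_split/=.
  apply: ler_sum => j _.
  have /andP[u_ge u_le] := UM _ j Uu; have /andP[v_ge v_le] := VM _ j Vv.
  set a := u ord0 j in u_ge u_le *; set b := v ord0 j in v_ge v_le *.
  rewrite -[leRHS]ger0_norm; last by rewrite addr_ge0 ?sqrtr_ge0// ltW.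
  rewrite -sqrtr_sqr ler_sqrt ?sqr_ge0// sqrrD sqr_sqrtr ?mulr_ge0//.
  have := mulr_ge0 (sqrtr_ge0 (a * b)) (ltW eta0).
  have : eps * (a + b + eps) <= eps * (2 * M + 1) by rewrite ler_pM2l//; lra.
  lra.
(* [K] bounds [mu + 1 / mu] for all the weights below, and [C * tau ^+ 2] the
   second-order error of a step [tau] towards a competitor. *)
pose K := 2 + (M + eps) / eps + (M + eps) / eps.
have K0 : 0 < K.
  by have : 0 <= (M + eps) / eps by [apply: divr_ge0; lra]; rewrite /K; lra.
pose C := n%:R * (M ^+ 2 * K / (2 * eps)).
have C0 : 0 <= C.
  apply: mulr_ge0 => //; apply: divr_ge0; last by lra.
  by apply: mulr_ge0; [exact: sqr_ge0|exact: ltW].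
pose tau := Num.min 1 (e / (3 * (C + 1))).
have tau0 : 0 < tau by rewrite lt_min ltr01 divr_gt0//; lra.
have tau1 : tau <= 1 by rewrite ge_min lexx.
have tauC : C * tau <= e / 3.
  have C1 : 0 < 3 * (C + 1) by lra.
  have : (C + 1) * tau <= e / 3.
    by rewrite mulrC -ler_pdivlMr ?ltr_wpDl// -mulrA -invfM ge_min lexx orbT.
  by rewrite mulrDl mul1r; lra.
pose A := [set psi w | w in [set w | U w.1 /\ V w.2]].
have supA : has_sup A.
  split; first by exists (psi (u0, v0)), (u0, v0).
  by exists (B + e / 3) => _ [[u v] [/= Uu Vv] <-]; exact: psiB.
have te0 : 0 < tau * (e / 3) by rewrite mulr_gt0// divr_gt0.
have [_ [[us vs] [/= Uus Vvs] <-] psi_max] := sup_adherent te0 supA.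
have psi_le u v : U u -> V v -> psi (u, v) <= psi (us, vs) + tau * (e / 3).
  move=> Uu Vv; have : psi (u, v) <= sup A.
    by apply: ub_le_sup; [case: supA|exists (u, v)].
  lra.
pose a j := us ord0 j + eps; pose b j := vs ord0 j + eps.
have a0 j : eps <= a j by have /andP[] := UM _ j Uus; rewrite /a; lra.
have b0 j : eps <= b j by have /andP[] := VM _ j Vvs; rewrite /b; lra.
have aM j : a j <= M + eps by have /andP[] := UM _ j Uus; rewrite /a; lra.
have bM j : b j <= M + eps by have /andP[] := VM _ j Vvs; rewrite /b; lra.
have ap j : 0 < a j by apply: lt_le_trans (a0 j).
have bp j : 0 < b j by apply: lt_le_trans (b0 j).
pose mu j := Num.sqrt (a j / b j).
have mu0 j : 0 < mu j by rewrite sqrtr_gt0 divr_gt0.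
have mu2 j : mu j ^+ 2 = a j / b j by rewrite sqr_sqrtr// divr_ge0// ltW.
have quot x y : eps <= x -> y <= M + eps -> y / x <= (M + eps) / eps.
  move=> ex yM; have x0 := lt_le_trans eps0 ex.
  have Me : 0 <= M + eps by lra.
  rewrite ler_pdivrMr// (le_trans yM)// mulrAC ler_pdivlMr//.
  by rewrite ler_wpM2l.
have muK j : (mu j)^-1 + mu j <= K.
  have sq_bound x : x <= 1 + x ^+ 2 :> R by have := sqr_ge0 (x - 1); nra.
  have := sq_bound (mu j); have := sq_bound (mu j)^-1; rewrite exprVn mu2 invf_div.
  have := quot _ _ (a0 j) (bM j); have := quot _ _ (b0 j) (aM j); rewrite /K; lra.
have c1 j : a j / mu j = Num.sqrt (a j * b j).
  apply: (mulIf (lt0r_neq0 (mu0 j))); rewrite divfK ?gt_eqF//.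
  rewrite -sqrtrM ?(ltW (mulr_gt0 (ap j) (bp j)))//.
  have -> : a j * b j * (a j / b j) = a j ^+ 2 by field; rewrite gt_eqF.
  by rewrite sqrtr_sqr gtr0_norm.
have c2 j : mu j * b j = Num.sqrt (a j * b j).
  rewrite -c1; apply: (mulIf (lt0r_neq0 (mu0 j))); rewrite divfK ?gt_eqF//.
  by rewrite mulrAC -expr2 mu2 divfK ?gt_eqF.
exists mu => // u v Uu Vv.
have UVt := psi_le _ _ (convex_set_segment cU Uu Uus (ltW tau0) tau1)
                       (convex_set_segment cV Vv Vvs (ltW tau0) tau1).
pose al j := u ord0 j - us ord0 j; pose be j := v ord0 j - vs ord0 j.
have main j : Num.sqrt (a j * b j) + tau * ((al j / mu j + mu j * be j) / 2)
    - tau ^+ 2 * (M ^+ 2 * K / (2 * eps)) <=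
  Num.sqrt (((tau *: u + (1 - tau) *: us) ord0 j + eps) *
            ((tau *: v + (1 - tau) *: vs) ord0 j + eps)).
  set Aj := _ + eps; set Bj := _ + eps.
  have eAj : Aj = a j + tau * al j by rewrite /Aj /a /al !mxE; ring.
  have eBj : Bj = b j + tau * be j by rewrite /Bj /b /be !mxE; ring.
  have Age : eps <= Aj.
    by have /andP[+ _] := UM _ j (convex_set_segment cU Uu Uus (ltW tau0) tau1);
      rewrite /Aj; lra.
  have Bge : eps <= Bj.
    by have /andP[+ _] := VM _ j (convex_set_segment cV Vv Vvs (ltW tau0) tau1);
      rewrite /Bj; lra.
  have m0 := mu0 j.
  have Ap : 0 < Aj / mu j by rewrite divr_gt0// (lt_le_trans eps0).
  have Bp : 0 < mu j * Bj by rewrite mulr_gt0// (lt_le_trans eps0).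
  have := geometric_mean_expansion Ap Bp.
  have -> : Aj / mu j * (mu j * Bj) = Aj * Bj by field; rewrite gt_eqF.
  apply: le_trans.
  have e1 : Aj / mu j = Num.sqrt (a j * b j) + tau * (al j / mu j).
    by rewrite eAj mulrDl c1 mulrA.
  have e2 : mu j * Bj = Num.sqrt (a j * b j) + tau * (mu j * be j).
    by rewrite eBj mulrDr c2 mulrCA.
  have sum_c : (Aj / mu j + mu j * Bj) / 2 = Num.sqrt (a j * b j) +
      tau * ((al j / mu j + mu j * be j) / 2) by rewrite e1 e2; lra.
  have dif_c : Aj / mu j - mu j * Bj = tau * (al j / mu j - mu j * be j).
    by rewrite e1 e2; ring.
  rewrite sum_c lerD2l lerN2 dif_c exprMn -[leLHS]mulrA ler_wpM2l ?sqr_ge0//.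
  set D := _ - _; set s := (mu j)^-1 + mu j in muK.
  have s0 : 0 < s by rewrite addr_gt0 ?invr_gt0.
  have AB : eps * s <= Aj / mu j + mu j * Bj.
    by rewrite mulrDr [mu j * Bj]mulrC lerD// ler_wpM2r// ?invr_ge0 ltW.
  have Ds : D ^+ 2 <= (M * s) ^+ 2.
    have al_le : `|al j| <= M.
      have /andP[? ?] := UM _ j Uu; have /andP[? ?] := UM _ j Uus.
      by rewrite ler_norml /al; lra.
    have be_le : `|be j| <= M.
      have /andP[? ?] := VM _ j Vv; have /andP[? ?] := VM _ j Vvs.
      by rewrite ler_norml /be; lra.
    rewrite -ler_sqrt ?sqr_ge0// !sqrtr_sqr (ger0_norm (mulr_ge0 M0 (ltW s0))).
    rewrite (le_trans (ler_normB _ _))// !normrM mulrDr normfV (gtr0_norm m0).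
    by rewrite [mu j * _]mulrC lerD// ler_wpM2r// ?invr_ge0 ltW.
  rewrite ler_pdivrMr ?mulr_gt0// ?addr_gt0//; apply: (le_trans Ds).
  have -> : M ^+ 2 * K / (2 * eps) * (2 * (Aj / mu j + mu j * Bj)) =
      M ^+ 2 * (K * ((Aj / mu j + mu j * Bj) / eps)).
    by field; rewrite !gt_eqF.
  rewrite exprMn ler_wpM2l ?sqr_ge0// expr2 ler_pM// ?(ltW s0)//; first exact: muK.
  by rewrite ler_pdivlMr// mulrC.
pose S1 := \sum_(j < n) (al j / mu j + mu j * be j) / 2.
have S1_le : S1 <= e / 3 + e / 3.
  have sum_main : psi (us, vs) + tau * S1 - tau ^+ 2 * C <= psi (us, vs) + tau * (e / 3).
    apply: le_trans UVt; rewrite /psi /S1 mulr_sumr -big_split/= /C.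
    have -> : tau ^+ 2 * (n%:R * (M ^+ 2 * K / (2 * eps))) =
        \sum_(j < n) tau ^+ 2 * (M ^+ 2 * K / (2 * eps)).
      by rewrite sumr_const card_ord -mulr_natl; ring.
    by rewrite -sumrB; apply: ler_sum => j _; exact: main.
  rewrite -(ler_pM2l tau0) mulrDr.
  have : tau * (C * tau) <= tau * (e / 3) by rewrite ler_wpM2l// ltW.
  rewrite expr2 in sum_main; lra.
have -> : \sum_(j < n) (u ord0 j / mu j + mu j * v ord0 j) / 2 =
    S1 + \sum_(j < n) (us ord0 j / mu j + mu j * vs ord0 j) / 2.
  rewrite -big_split/=; apply: eq_bigr => j _; rewrite /al /be.
  by field; rewrite gt_eqF.
have : \sum_(j < n) (us ord0 j / mu j + mu j * vs ord0 j) / 2 <= psi (us, vs).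
  apply: ler_sum => j _.
  have : us ord0 j / mu j <= a j / mu j by rewrite ler_wpM2r ?invr_ge0 ?ltW// /a; lra.
  have : mu j * vs ord0 j <= mu j * b j by rewrite ler_wpM2l ?ltW// /b; lra.
  by rewrite c1 c2 /=; lra.
have := psiB _ _ Uus Vvs; lra.
Qed.

End scaling.
(** * Diagonally scaled gradient descent *)

Section gradient_descent.
Context {R : realType} {n : nat}.
Implicit Types (f : 'rV[R]_n -> R) (x y g lam : 'rV[R]_n).

Definition ogd_step lam x f : 'rV[R]_n :=
  \row_j (x ord0 j - lam ord0 j * subgrad f x ord0 j).

Definition ogd lam : @rule R n := foldl (ogd_step lam) 0.

Lemma observe_take_rcons d (S : measurableType d) (F : 'rV[R]_n -> S -> R)
    k (t : k.-tuple S) (i : 'I_k) :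
  observe F (take i.+1 t) = rcons (observe F (take i t)) (F^~ (tnth t i)).
Proof.
have x0 := tnth t i; rewrite (take_nth x0) ?size_tuple//.
by rewrite /observe map_rcons (tnth_nth x0).
Qed.

Lemma ogd_take_S lam d (S : measurableType d) (F : 'rV[R]_n -> S -> R)
    k (t : k.-tuple S) (i : 'I_k) :
  ogd lam (observe F (take i.+1 t)) =
  ogd_step lam (ogd lam (observe F (take i t))) (F^~ (tnth t i)).
Proof. by rewrite observe_take_rcons /ogd foldl_rcons. Qed.

Lemma ogd_measurable gamma lam d (S : measurableType d) k : is_norm gamma ->
  @measurable_rule R n d S gamma k (ogd lam).
Proof.
move=> /loss_class_lipschitz[L L0 FL] F lF.
suff meas m : (m <= k)%N -> forall j : 'I_n, measurable_fun [set: k.-tuple S]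
    (fun t : k.-tuple S => ogd lam (observe F (take m t)) ord0 j).
  move=> j; have := meas k (leqnn k) j; congr (measurable_fun _ _).
  by apply/funext => t; rewrite take_oversize ?size_tuple.
elim: m => [|m IH] mk j.
  rewrite (_ : (fun t => _) = cst 0); first exact: measurable_cst.
  by apply/funext => t; rewrite take0 mxE.
pose i := Ordinal mk.
rewrite (_ : (fun t => _) = (fun t : k.-tuple S =>
    ogd lam (observe F (take i t)) ord0 j - lam ord0 j *
    subgrad (F^~ (tnth t i)) (ogd lam (observe F (take i t))) ord0 j)); last first.
  by apply/funext => t; rewrite (ogd_take_S _ _ _ i) mxE.
have {}IH := IH (ltnW mk).
apply: measurable_funB; first exact: IH.
apply: measurable_funM => //.
apply: (measurable_subgrad (F := fun x (t : k.-tuple S) => F x (tnth t i)) L0) => //.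
- by move=> t; exact: loss_class_convex lF.
- move=> x; apply: measurableT_comp; last exact: measurable_tnth.
  by case: lF.
- by move=> t; exact: FL lF _.
Qed.

(** The squared distance to [x], divided by [2 * lam], is a potential: one step
    changes it by the regret of the step, up to [lam * g i ^+ 2 / 2]. *)
Lemma gradient_descent_regret (k : nat) (y g : nat -> R) (x lam : R) : 0 < lam ->
  y 0%N = 0 -> (forall i, (i < k)%N -> y i.+1 = y i - lam * g i) ->
  \sum_(i < k) g i * (y i - x) <=
    x ^+ 2 / (2 * lam) + \sum_(i < k) lam * g i ^+ 2 / 2.
Proof.
move=> lam0 y0 yS.
suff E m : (m <= k)%N -> \sum_(i < m) g i * (y i - x) =
    x ^+ 2 / (2 * lam) - (y m - x) ^+ 2 / (2 * lam) +
    \sum_(i < m) lam * g i ^+ 2 / 2.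
  by rewrite E// lerD2r gerBl divr_ge0 ?sqr_ge0// mulr_ge0// ltW.
elim: m => [|m IH] mk; first by rewrite !big_ord0 y0; field; rewrite gt_eqF.
rewrite !big_ord_recr/= IH ?(ltnW mk)// yS//.
by field; rewrite gt_eqF.
Qed.

Lemma ogd_avg_regret gamma lam d (S : measurableType d) (F : 'rV[R]_n -> S -> R)
    k (s : k.-tuple S) x (B : R) :
  (0 < k)%N -> loss_class gamma F -> (forall j, 0 < lam ord0 j) ->
  (forall g, unit_ball gamma g -> \sum_(j < n)
     (x ord0 j ^+ 2 / (2 * lam ord0 j * k%:R) + lam ord0 j * g ord0 j ^+ 2 / 2) <= B) ->
  avg_regret (ogd lam) F s x <= B.
Proof.
move=> k0 lF lam0 gB; have kp : 0 < k%:R :> R by rewrite ltr0n.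
pose y i := ogd lam (observe F (take i s)).
(* Indexed by [nat] to match the potential argument; 0 past the last round. *)
pose g i := if insub i is Some i' then subgrad (F^~ (tnth s i')) (y i) else 0.
have gE (i : 'I_k) : g i = subgrad (F^~ (tnth s i)) (y i).
  by rewrite /g valK.
have step j : \sum_(i < k) g i ord0 j * (y i ord0 j - x ord0 j) <=
    x ord0 j ^+ 2 / (2 * lam ord0 j) + \sum_(i < k) lam ord0 j * g i ord0 j ^+ 2 / 2.
  apply: (gradient_descent_regret (y := fun i => y i ord0 j)
    (g := fun i => g i ord0 j)) => //.
    by rewrite /y take0 mxE.
  by move=> i ik; rewrite /y (ogd_take_S _ _ _ (Ordinal ik)) mxE (gE (Ordinal ik)).
rewrite /avg_regret ler_pdivrMl//.
apply: (@le_trans _ _ (\sum_(i < k) dotv (g i) (y i - x))).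
  apply: ler_sum => i _; rewrite gE.
  exact: subgrad_le (loss_class_convex (tnth s i) lF).
rewrite /dotv exchange_big/=.
apply: (@le_trans _ _ (\sum_(i < k) \sum_(j < n)
  (x ord0 j ^+ 2 / (2 * lam ord0 j * k%:R) + lam ord0 j * g i ord0 j ^+ 2 / 2))).
  rewrite [leRHS]exchange_big/=; apply: ler_sum => j _.
  under eq_bigr do rewrite [(y _ - x) _ _]mxE [(- x) _ _]mxE.
  apply: (le_trans (step j)); rewrite big_split/= lerD2r sumr_const card_ord.
  rewrite -[_ *+ k]mulr_natl le_eqVlt; apply/orP; left; apply/eqP.
  by field; rewrite !gt_eqF.
rewrite mulr_natl -[X in B *+ X]card_ord -sumr_const.
by apply: ler_sum => i _; apply: gB; rewrite gE; exact: loss_class_subgrad lF.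
Qed.

End gradient_descent.
(** * The quadratic hull and the upper bound *)

Section quadratic_hull.
Context {R : realType} {n : nat}.
Implicit Types (A C : set 'rV[R]_n).

Lemma Conv_convex A : convex_set (Conv A : set (convex_lmodType 'rV[R]_n)).
Proof.
move=> x y t /set_mem Ax /set_mem Ay; apply/mem_set => C [cC AC].
by apply/set_mem/cC; apply/mem_set; [exact: Ax|exact: Ay].
Qed.

Lemma sub_Conv A : A `<=` Conv A.
Proof. by move=> x Ax D [_ AD]; exact: AD. Qed.

Lemma Conv_sqr_box A (M : R) :
  (forall g, A g -> forall j, `|g ord0 j| <= M) ->
  forall v j, Conv (sqrv @` A) v -> 0 <= v ord0 j <= M ^+ 2.
Proof.
move=> AM v j; move: v.
apply: (@smallest_sub _ _ _ [set v : 'rV[R]_n | 0 <= v ord0 j <= M ^+ 2]).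
  move=> x y t; rewrite !inE /= => /andP[x0 xM] /andP[y0 yM].
  have t0 : 0 <= t%:num :> R by [].
  have t1 : t%:num <= 1 :> R by [].
  rewrite (_ : conv t x y = t%:num *: x + (1 - t%:num) *: y)// !mxE.
  set s := t%:num in t0 t1 *; have s1 : 0 <= 1 - s by lra.
  rewrite addr_ge0 ?mulr_ge0//=.
  have := ler_wpM2l t0 xM; have := ler_wpM2l s1 yM; lra.
move=> _ [g /AM gM <-] /=; rewrite mxE sqr_ge0/= -[g _ _ ^+ 2]real_normK ?num_real//.
by rewrite lerXn2r ?nnegrE//; exact: le_trans (gM j).
Qed.

(** The signs of [x] turn the sum of square roots into a scalar product with an
    element of the hull. *)
Lemma QHull_bound A (x v : 'rV[R]_n) (B : R) :
  (forall g, QHull A g -> dotv x g <= B) -> Conv (sqrv @` A) v ->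
  \sum_j Num.sqrt (x ord0 j ^+ 2 * v ord0 j) <= B.
Proof.
move=> xB Av; pose s j := x ord0 j < 0.
have := xB (flip s (sqrtv v)); move/(_ (ex_intro _ v (ex_intro _ s (conj Av erefl)))).
congr (_ <= _); apply: eq_bigr => j _.
rewrite !mxE sqrtrM ?sqr_ge0// sqrtr_sqr mulrA; congr (_ * _).
by rewrite /s; case: ltrP => xj /=; 
  rewrite ?(expr0, expr1) ?mulr1 ?mulrN1 ?(ltr0_norm xj) ?ger0_norm.
Qed.

End quadratic_hull.

Section upper_bound.
Context {R : realType} {n : nat}.
Implicit Types (X : set 'rV[R]_n) (gamma : 'rV[R]_n -> R).

Lemma compact_coord_bounded X : compact X ->
  exists2 M : R, 0 <= M & forall x, X x -> forall j, `|x ord0 j| <= M.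
Proof.
move=> /compact_bounded[M [_ XM]]; exists (`|M| + 1); first by rewrite addr_ge0.
move=> x Xx j; apply: (le_trans (coord_le_norm _ _)).
by apply: XM => //; rewrite ltr_pwDr// ler_norm.
Qed.

(** The weights bound each round separately, since the square of any single
    subgradient already lies in [Conv (sqrv @` unit_ball gamma)]. *)
Lemma regret_upper_bound X gamma k (B e : R) : (0 < k)%N -> X !=set0 ->
  quadratically_convex X -> compact X -> is_norm gamma ->
  (forall x g, X x -> QHull (unit_ball gamma) g -> dotv x g <= B) -> 0 < e ->
  exists2 xhat : @rule R n,
    forall d (S : measurableType d) i, @measurable_rule R n d S gamma i xhat &
    forall d (S : measurableType d) (F : 'rV[R]_n -> S -> R) (s : k.-tuple S) x,
      loss_class gamma F -> X x ->
      avg_regret xhat F s x <= (Num.sqrt k%:R)^-1 * (B + e).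
Proof.
move=> k0 [x0 Xx0] qX cX gn XB e0; have kp : 0 < k%:R :> R by rewrite ltr0n.
have [M1 M10 XM] := compact_coord_bounded cX.
have [M2 M20 gM] := unit_ball_bounded gn.
pose M := M1 ^+ 2 + M2 ^+ 2.
have [|||||||mu mu0 muB] :=
  @near_optimal_weights R n (sqrv @` X) (Conv (sqrv @` unit_ball gamma)) M B e
    _ _ _ qX (@Conv_convex _ _ _).
- by rewrite addr_ge0 ?sqr_ge0.
- by exists (sqrv x0), x0.
- exists (sqrv 0); apply: sub_Conv; exists 0 => //.
  by rewrite /unit_ball/= (is_norm0 gn).
- move=> _ j [x Xx <-]; rewrite mxE sqr_ge0/= -real_normK ?num_real//.
  by rewrite (le_trans (lerXn2r 2 _ _ (XM x Xx j))) ?nnegrE// lerDl sqr_ge0.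
- move=> v j Vv; have /andP[-> vM] := Conv_sqr_box gM j Vv.
  by rewrite (le_trans vM)// lerDr sqr_ge0.
- move=> _ v [x Xx <-] Vv; under eq_bigr do rewrite mxE.
  by apply: QHull_bound Vv => g; exact: XB.
- exact: e0.
pose rk : R := Num.sqrt k%:R; have rk0 : 0 < rk by rewrite sqrtr_gt0.
have rk2 : rk ^+ 2 = k%:R by rewrite sqr_sqrtr// ltW.
pose lam : 'rV[R]_n := \row_j (mu j / rk).
exists (ogd lam) => [d S i|d S F s x lF Xx]; first exact: ogd_measurable.
apply: (@ogd_avg_regret R n gamma lam d S F k s x _ k0 lF) => [j|g g1].
  by rewrite mxE divr_gt0.
have Vg : Conv (sqrv @` unit_ball gamma) (sqrv g) by apply: sub_Conv; exists g.
have := muB (sqrv x) (sqrv g) (ex_intro2 _ _ x Xx erefl) Vg.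
rewrite -(ler_pM2l (x := rk^-1)) ?invr_gt0//; apply: le_trans.
rewrite mulr_sumr; apply: ler_sum => j _; rewrite !mxE -rk2.
rewrite le_eqVlt; apply/orP; left; apply/eqP; field.
by rewrite !gt_eqF.
Qed.

Lemma regret_minimax_upper X gamma k : (0 < k)%N -> X !=set0 ->
  quadratically_convex X -> compact X -> is_norm gamma ->
  (regret_minimax X gamma k <=
         (1 / Num.sqrt k%:R)%:E *
         ereal_sup [set ereal_sup [set (dotv x g)%:E
                                  | g in QHull (unit_ball gamma)]
                   | x in X])%E.
Proof.
move=> k0 X0 qX cX gn; set V := ereal_sup [set _ | x in X].
have rk0 : 0 < (Num.sqrt k%:R)^-1 :> R by rewrite invr_gt0 sqrtr_gt0 ltr0n.
have VB x g : X x -> QHull (unit_ball gamma) g -> ((dotv x g)%:E <= V)%E.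
  move=> Xx Qg; apply: (@le_trans _ _ (ereal_sup [set (dotv x g)%:E
                                  | g in QHull (unit_ball gamma)])).
    by apply: ereal_sup_ubound; exists g.
  by apply: ereal_sup_ubound; exists x.
rewrite div1r; case: V VB => [B|_|VB].
- move=> VB; rewrite -EFinM; apply/lee_addgt0Pr => e e0.
  have e'0 : 0 < e * Num.sqrt k%:R by rewrite mulr_gt0// -invr_gt0.
  have [xhat mx xB] := regret_upper_bound k0 X0 qX cX gn VB e'0.
  apply: ge_ereal_sup => _ [d [S ->]].
  apply: (@le_trans _ _ (ereal_sup
    [set ereal_sup [set (avg_regret xhat Fs.1 Fs.2 x)%:E | x in X] | Fs in @loss_class R n d S gamma `*` [set: k.-tuple S]])).
    by apply: ereal_inf_lbound; exists xhat => // i _; exact: mx.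
  apply: ge_ereal_sup => _ [[F s] [/= lF _] <-]; apply: ge_ereal_sup => _ [x Xx <-].
  rewrite lee_fin (le_trans (xB _ _ _ _ _ lF Xx))//.
  by rewrite mulrDr [e * _]mulrC mulKf// -invr_eq0 gt_eqF.
- by rewrite gt0_muley ?leey// lte_fin.
- have [x Xx] := X0.
  exfalso; have : QHull (unit_ball gamma) (flip (fun=> false) (sqrtv (sqrv 0))).
    exists (sqrv 0), (fun=> false); split=> //; apply: sub_Conv; exists 0 => //.
    by rewrite /unit_ball/= (is_norm0 gn).
  by move/(VB _ _ Xx); rewrite leeNy_eq.
Qed.

End upper_bound.
(** * From regret to risk: the online-to-batch conversion *)

Section quasi_integral.
Context {R : realType}.
Local Open Scope ereal_scope.

(** Differences of infinite integrals follow the convention [+oo - +oo = -oo];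
    moving the terms across makes all four of them nonnegative. *)
Lemma leeB_cross (a b p m : \bar R) :
  0 <= a -> 0 <= b -> p \is a fin_num -> m \is a fin_num ->
  (a - b <= p - m) = (a + m <= p + b).
Proof.
case: a => [a||]; case: b => [b||]//; case: p => [p||]//; case: m => [m||]//= _ _ _ _.
- by rewrite -!EFinB -!EFinD !lee_fin; apply/idP/idP; lra.
- by rewrite addeNy addey// leNye leey.
- by rewrite addeNy addey// leNye leey.
Qed.

Context d (T : measurableType d).

Lemma le_integral_quasi (mu : {measure set T -> \bar R}) (f g : T -> \bar R) :
  measurable_fun setT f -> measurable_fun setT g -> (forall t, f t <= g t) ->
  \int[mu]_t f t <= \int[mu]_t g t.
Proof.
move=> mf mg fg; rewrite integralE [leRHS]integralE; apply: leeB.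
- apply: ge0_le_integral => //; try exact: measurable_funepos.
  by move=> t _; apply: (@funepos_le _ _ setT) => //; rewrite inE.
- apply: ge0_le_integral => //; try exact: measurable_funeneg.
  by move=> t _; apply: (@funeneg_le _ _ setT) => //; rewrite inE.
Qed.

Context d' (T' : measurableType d').

(** One half of Fubini's theorem, for a function whose positive and negative
    parts may both have infinite integral: then the left-hand side is [-oo]. *)
Lemma integral_prod_le (P : probability T R) (Q : probability T' R)
    (g : T * T' -> R) (c : T -> R) :
  measurable_fun setT g -> P.-integrable setT (EFin \o c) ->
  (forall s, \int[Q]_t (g (s, t))%:E <= (c s)%:E) ->
  \int[P \x Q]_w (g w)%:E <= \int[P]_s (c s)%:E.
Proof.
move=> mg ic gc; pose h w := (g w)%:E.
have mh : measurable_fun setT h by exact/measurable_EFinP.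
have mhp := measurable_funepos mh; have mhn := measurable_funeneg mh.
rewrite -[X in X <= _]/(\int[P \x Q]_w h w).
rewrite integralE [leRHS]integralE !fubini_tonelli1//.
have mc : measurable_fun setT (EFin \o c) by case/integrableP: ic.
have fubini_F_ge0 (k : T * T' -> \bar R) : (forall w, 0 <= k w) ->
    forall s, 0 <= fubini_F Q k s.
  by move=> k0 s; apply: integral_ge0.
rewrite leeB_cross; last 4 first.
- by apply: integral_ge0 => s _; exact: fubini_F_ge0.
- by apply: integral_ge0 => s _; exact: fubini_F_ge0.
- exact: (integrable_pos_fin_num _ ic).
- exact: (integrable_neg_fin_num _ ic).
have mF (k : T * T' -> \bar R) : measurable_fun setT k -> (forall w, 0 <= k w) ->
    measurable_fun setT (fubini_F Q k).
  by move=> mk k0; exact: measurable_fun_fubini_tonelli_F.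
have mFp := mF _ mhp (funepos_ge0 h); have mFn := mF _ mhn (funeneg_ge0 h).
have Fp0 := fubini_F_ge0 _ (funepos_ge0 h).
have Fn0 := fubini_F_ge0 _ (funeneg_ge0 h).
have mcp := measurable_funepos mc; have mcn := measurable_funeneg mc.
rewrite -!ge0_integralD//.
apply: ge0_le_integral => //.
- by move=> s _; apply: adde_ge0.
- exact: emeasurable_funD.
- exact: emeasurable_funD.
move=> s _; rewrite -leeB_cross.
- have -> : fubini_F Q h^\+ s = \int[Q]_t (fun t => (g (s, t))%:E)^\+ t.
    by apply: eq_integral => t _; rewrite !funeposE.
  have -> : fubini_F Q h^\- s = \int[Q]_t (fun t => (g (s, t))%:E)^\- t.
    by apply: eq_integral => t _; rewrite !funenegE.
  rewrite -integralE (le_trans (gc s))//.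
  by rewrite -[leLHS]/((EFin \o c) s) [in leLHS](funeposneg (EFin \o c)).
- exact: fubini_F_ge0.
- exact: fubini_F_ge0.
- by rewrite funeposE -EFin_max.
- by rewrite funenegE -EFinN -EFin_max.
Qed.

Lemma integral_quasi_pushforward (mu : {measure set T -> \bar R})
    (phi : {mfun T >-> T'}) (f : T' -> \bar R) : measurable_fun setT f ->
  \int[pushforward mu phi]_y f y = \int[mu]_x f (phi x).
Proof.
move=> mf; have mphi : measurable_fun setT phi by [].
rewrite [LHS]integralE [RHS]integralE.
rewrite (ge0_integral_pushforward mphi mu measurableT (measurable_funepos mf)); last first.
  by move=> y _; exact: funepos_ge0.
rewrite (ge0_integral_pushforward mphi mu measurableT (measurable_funeneg mf)); last first.
  by move=> y _; exact: funeneg_ge0.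
rewrite preimage_setT -funepos_comp -funeneg_comp; reflexivity.
Qed.

End quasi_integral.
Lemma integral_prob_cst {d : measure_display} {T : measurableType d}
    {R : realType} (Q : probability T R) (b : R) : (\int[Q]_t b%:E = b%:E)%E.
Proof.
rewrite [LHS](_ : _ = (\int[Q]_s cst b%:E s)%E)// integral_cst//.
by rewrite -[RHS]mule1 -(probability_setT Q).
Qed.

Section online_to_batch.
Context {R : realType} {n : nat} {d : measure_display} {S : measurableType d}.
Implicit Types (Y : seq S -> 'rV[R]_n) (g : seq S -> R).

Lemma measurable_take g i k : (i <= k)%N ->
  measurable_fun [set: i.-tuple S] (fun t : i.-tuple S => g t) ->
  measurable_fun [set: k.-tuple S] (fun t : k.-tuple S => g (take i t)).
Proof.
move=> ik mg; pose tk (t : k.-tuple S) := [tuple tnth t (widen_ord ik j) | j < i].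
rewrite (_ : (fun t => _) = (fun t : i.-tuple S => g t) \o tk).
  apply: measurableT_comp => //; apply/measurable_fun_tnthP => j.
  rewrite (_ : _ \o _ = fun t : k.-tuple S => tnth t (widen_ord ik j)).
    exact: measurable_tnth.
  by apply/funext => t /=; rewrite tnth_mktuple.
apply/funext => t /=; congr g.
case: i ik @tk mg => [|i] ik tk _; first by rewrite take0;
  apply/esym/size0nil/(size_tuple (tk t)).
have x0 := tnth t (widen_ord ik ord0).
apply: (@eq_from_nth _ x0) => [|j].
  by rewrite (size_tuple (tk t)) size_takel// size_tuple.
rewrite size_takel ?size_tuple// => ji; rewrite nth_take//.
have -> : nth x0 (tk t) j = tnth (tk t) (Ordinal ji) by rewrite (tnth_nth x0).
by rewrite tnth_mktuple (tnth_nth x0).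
Qed.

Lemma measurable_cons_fix g i (s : S) :
  measurable_fun [set: i.+1.-tuple S] (fun t : i.+1.-tuple S => g t) ->
  measurable_fun [set: i.-tuple S] (fun t : i.-tuple S => g (s :: t)).
Proof.
move=> mg.
have := measurableT_comp mg (measurable_cons (@measurable_cst _ _ (i.-tuple S) _ setT s)
   (@measurable_id _ (i.-tuple S) setT)).
by [].
Qed.

Variables (P : probability S R) (F : 'rV[R]_n -> S -> R) (L : R).
Hypotheses (L0 : 0 <= L) (FL : forall s, l1_lipschitz L (F^~ s)).
Hypotheses (mF : forall x, measurable_fun setT (F x)) (PF : admissible_law F P).

Let f x := fine (pop_loss P F x).

Lemma pop_lossE x : pop_loss P F x = (f x)%:E.
Proof. by rewrite fineK//; exact: (integrable_fin_num _ (PF x)). Qed.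

Lemma pop_loss_affine x y (p q b : R) :
  P.-integrable setT (EFin \o (fun s => p * F x s + q * F y s + b)) /\
  (\int[P]_s (p * F x s + q * F y s + b)%:E = (p * f x + q * f y + b)%:E)%E.
Proof.
have ix := integrableZl measurableT p (PF x).
have iy := integrableZl measurableT q (PF y).
have ib := finite_measure_integrable_cst P b measurableT.
have ixy := integrableD measurableT ix iy.
split; first exact: (integrableD measurableT ixy ib).
rewrite (integralD measurableT ixy ib) (integralD measurableT ix iy).
rewrite !integralZl//; [|exact: PF..].
have e z : (\int[P]_s (EFin \o F z) s = (f z)%:E)%E by exact: pop_lossE.
rewrite !e.
by rewrite -[(\int[P]_s (EFin \o cst b) s)%E]/(\int[P]_s b%:E)%E integral_prob_cst.
Qed.

Lemma pop_loss_lipschitz : l1_lipschitz L f.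
Proof.
move=> x y; rewrite lerBlDr addrC -[f y]mul1r -[X in X + _]addr0.
rewrite -[X in _ + X + _](mul0r (f y)).
have [i1 e1] := pop_loss_affine y y 1 0 (L * l1norm (x - y)).
rewrite -lee_fin -pop_lossE -e1; apply: le_integral => //; first exact: PF.
move=> s _; rewrite /= lee_fin mul1r mul0r addr0 -lerBlDl; exact: FL.
Qed.

Lemma pop_loss_convex : (forall s, convex_fun (F^~ s)) -> convex_fun f.
Proof.
move=> cF x y s t s0 t0 st; have [i1 e1] := pop_loss_affine x y s t 0.
rewrite -[leRHS]addr0 -lee_fin -e1 -pop_lossE; apply: le_integral => //; first exact: PF.
by move=> u _; rewrite /= addr0 lee_fin cF.
Qed.

Lemma integral_power_probS k (h : k.+1.-tuple S -> R) : measurable_fun setT h ->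
  (\int[power_prob P k.+1]_t (h t)%:E =
   \int[P \x power_prob P k]_w (h (consp w))%:E)%E.
Proof.
move=> mh; apply: (integral_quasi_pushforward _ (@consp _ S k)).
exact/measurable_EFinP.
Qed.

(** The play [Y (take i t)] depends on the first [i] samples only, so that
    integrating over the next one replaces [F] by its mean [f].  The samples are
    integrated one at a time, the last one innermost, so that the regret bound
    is used at fixed values of the earlier samples.  The constant [a] collects
    the excess losses of the plays already made. *)
Lemma integral_regret_le k Y (x : 'rV[R]_n) (w a c : R) :
  (forall i, (i < k)%N -> forall j,
    measurable_fun [set: i.-tuple S] (fun t : i.-tuple S => Y t ord0 j)) ->
  (forall t : k.-tuple S, \sum_(i < k)
     w * (F (Y (take i t)) (tnth t i) - F x (tnth t i)) <= c) ->
  (\int[power_prob P k]_t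
    (a + \sum_(i < k) w * (f (Y (take i t)) - f x))%:E <= (a + c)%:E)%E.
Proof.
elim: k Y a c => [|k IH] Y a c mY Yc.
  under eq_integral do rewrite big_ord0 addr0.
  rewrite integral_prob_cst lee_fin lerDl.
  by have := Yc [tuple]; rewrite big_ord0.
have mfY (i : nat) : (i < k.+1)%N ->
    measurable_fun [set: i.-tuple S] (fun t : i.-tuple S => f (Y t)).
  move=> ik; apply: (measurable_lipschitz_comp (F := fun x _ => f x) L0) => //.
    by move=> _; exact: pop_loss_lipschitz.
  exact: mY.
have mh : measurable_fun setT (fun t : k.+1.-tuple S =>
    a + \sum_(i < k.+1) w * (f (Y (take i t)) - f x)).
  apply: measurable_funD => //; apply: measurable_sum => i.
  apply: measurable_funM => //; apply: measurable_funB => //.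
  apply: (measurable_take (g := fun t => f (Y t))); first exact/ltnW.
  exact: mfY.
rewrite (integral_power_probS mh).
pose c' s := a + w * (f (Y [::]) - f x) + (c - w * (F (Y [::]) s - F x s)).
have c'E : c' = fun s => - w * F (Y [::]) s + w * F x s +
    (a + w * (f (Y [::]) - f x) + c) by apply/funext => s; rewrite /c'; ring.
have [ic' Ic'] := pop_loss_affine (Y [::]) x (- w) w (a + w * (f (Y [::]) - f x) + c).
apply: (@le_trans _ _ (\int[P]_s (c' s)%:E)%E); last first.
  by rewrite c'E Ic' lee_fin; lra.
apply: integral_prod_le.
- exact: (measurableT_comp mh (measurable_funPT (@consp _ S k))).
- by rewrite c'E.
- move=> s; under eq_integral do rewrite big_ord_recl/= addrA.
apply: (IH (fun t => Y (s :: t))).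
  move=> i ik j; apply: (measurable_cons_fix (g := fun t => Y t ord0 j)).
  exact: mY.
move=> t; rewrite lerBrDl.
have := Yc [tuple of s :: t]; rewrite big_ord_recl/=; congr (_ <= _).
congr (_ + _); apply: eq_bigr => i _.
by rewrite !tnthS.
Qed.

End online_to_batch.
Lemma convex_fun_average {R : realType} {V : lmodType R} (f : V -> R) k (y : nat -> V) :
  convex_fun f -> (0 < k)%N ->
  f (k%:R^-1 *: \sum_(i < k) y i) <= k%:R^-1 * \sum_(i < k) f (y i).
Proof.
move=> cf; case: k => // k _; elim: k => [|k IH].
  by rewrite !big_ord1 invr1 scale1r mul1r.
have k0 : 0 < k.+1%:R :> R by [].
have k20 : 0 < k.+2%:R :> R by [].
have a0 : 0 <= k.+1%:R / k.+2%:R :> R by rewrite divr_ge0.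
have b0 : 0 <= k.+2%:R^-1 :> R by rewrite invr_ge0.
have ab : k.+1%:R / k.+2%:R + k.+2%:R^-1 = 1 :> R.
  by rewrite -[X in _ + X]mul1r -mulrDl natr1 divff.
rewrite !(big_ord_recr k.+1)/= scalerDr mulrDr.
have -> : k.+2%:R^-1 *: (\sum_(i < k.+1) y i) =
    (k.+1%:R / k.+2%:R) *: (k.+1%:R^-1 *: \sum_(i < k.+1) y i).
  by rewrite scalerA mulrAC divff// mul1r.
apply: (le_trans (cf _ _ _ _ a0 b0 ab)); rewrite lerD2r.
by rewrite (le_trans (ler_wpM2l a0 IH))// mulrA [_ / _ / _]mulrAC divff// mul1r.
Qed.

Section stochastic_vs_regret.
Context {R : realType} {n : nat}.
Implicit Types (X : set 'rV[R]_n) (gamma : 'rV[R]_n -> R).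

Definition average_rule k (xhat : @rule R n) : @rule R n :=
  fun fs => k%:R^-1 *: \sum_(i < k) xhat (take i fs).

Lemma average_rule_measurable gamma k xhat d (S : measurableType d) :
  (forall i, (i < k)%N -> @measurable_rule R n d S gamma i xhat) ->
  @measurable_rule R n d S gamma k (average_rule k xhat).
Proof.
move=> mx F lF j; rewrite /average_rule.
under eq_fun do rewrite mxE summxE.
apply: measurable_funM => //; apply: measurable_sum => i.
under eq_fun do rewrite /observe -map_take.
apply: (measurable_take (g := fun t => xhat (observe F t) ord0 j)).
  exact/ltnW.
exact: mx.
Qed.

Lemma lipschitz_bounded_below (L : R) f X : 0 <= L -> l1_lipschitz L f ->
  compact X -> exists b : R, forall x, X x -> b <= f x.
Proof.
move=> L0 Lf /compact_coord_bounded[M M0 XM].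
exists (f 0 - L * \sum_(j < n) M) => x Xx.
have : L * l1norm (0 - x) <= L * \sum_(j < n) M.
  by rewrite ler_wpM2l// ler_sum// => j _; rewrite !mxE add0r normrN XM.
by have := Lf 0 x; lra.
Qed.

(** By convexity the excess loss of the average is at most the average excess
    loss of the plays, which [integral_regret_le] bounds by the regret against a
    near-minimiser of the mean loss. *)
Lemma stoch_risk_average_le X gamma k xhat d (S : measurableType d)
    (F : 'rV[R]_n -> S -> R) (P : probability S R) (rho : R) :
  (0 < k)%N -> X !=set0 -> compact X -> is_norm gamma ->
  (forall i, (i < k)%N -> @measurable_rule R n d S gamma i xhat) ->
  loss_class gamma F -> admissible_law F P ->
  (forall (t : k.-tuple S) x, X x -> avg_regret xhat F t x <= rho) ->
  (stoch_risk X k (average_rule k xhat) F P <= rho%:E)%E.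
Proof.
move=> k0 [x0 Xx0] cX gn mx lF PF rhoP.
have kp : 0 < k%:R :> R by rewrite ltr0n.
have [L L0 FL] := loss_class_lipschitz gn; have {}FL := FL _ _ _ lF.
have mF : forall x, measurable_fun setT (F x) by case: lF.
pose f x := fine (pop_loss P F x).
have fE x : pop_loss P F x = (f x)%:E by exact: pop_lossE.
have fL : l1_lipschitz L f by exact: pop_loss_lipschitz.
have cf : convex_fun f by apply: pop_loss_convex => // s; exact: loss_class_convex lF.
have mfY (g : seq S -> 'rV[R]_n) i :
    (forall j, measurable_fun [set: i.-tuple S] (fun t : i.-tuple S => g t ord0 j)) ->
    measurable_fun [set: i.-tuple S] (fun t : i.-tuple S => f (g t)).
  by move=> mg; apply: (measurable_lipschitz_comp (F := fun x _ => f x) L0).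
have [b bf] := lipschitz_bounded_below L0 fL cX.
have infR : ereal_inf (pop_loss P F @` X) \is a fin_num.
  rewrite fin_numE; apply/andP; split; apply/eqP => h.
    have : (b%:E <= ereal_inf (pop_loss P F @` X))%E.
      by apply: le_ereal_inf_tmp => _ [x Xx <-]; rewrite fE lee_fin bf.
    by rewrite h leeNy_eq.
  have : (ereal_inf (pop_loss P F @` X) <= pop_loss P F x0)%E.
    by apply: ereal_inf_lbound; exists x0.
  by rewrite h fE leye_eq.
apply/lee_addgt0Pr => e e0.
have [_ [x Xx <-]] := lb_ereal_inf_adherent e0 infR.
rewrite fE -(fineK infR) -EFinD lte_fin; set I := fine _ => xI.
pose Y t := xhat (observe F t).
apply: (@le_trans _ _ (\int[power_prob P k]_t
    (e + \sum_(i < k) k%:R^-1 * (f (Y (take i t)) - f x))%:E)%E).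
  apply: le_integral_quasi.
  - under eq_fun do rewrite fE -(fineK infR) -EFinB.
    apply/measurable_EFinP.
    apply: measurable_funB => //.
    apply: (mfY (fun t => average_rule k xhat (observe F t))) => j.
    exact: (average_rule_measurable mx).
  - apply/measurable_EFinP; apply: measurable_funD => //.
    apply: measurable_sum => i; apply: measurable_funM => //.
    apply: measurable_funB => //.
    apply: (measurable_take (g := fun t => f (Y t))); first exact/ltnW.
    by apply: mfY => j; exact: mx.
  move=> t; rewrite fE -(fineK infR) -/I -EFinB lee_fin.
  have := convex_fun_average (fun i => Y (take i t)) cf k0.
  rewrite -mulr_sumr sumrB sumr_const card_ord mulrBr -[f x *+ _]mulr_natl.
  rewrite mulKf ?gt_eqF// /average_rule.
  have -> : \sum_(i < k) xhat (take i (observe F t)) = \sum_(i < k) Y (take i t).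
    by apply: eq_bigr => i _; rewrite /Y /observe map_take.
  by lra.
rewrite addeC -EFinD; apply: (integral_regret_le L0) => //.
- by move=> i ik j; exact: mx.
by move=> t; have := rhoP t x Xx; rewrite /avg_regret mulr_sumr.
Qed.

Lemma stoch_minimax_le_regret X gamma k : (0 < k)%N -> X !=set0 ->
  compact X -> is_norm gamma ->
  (stoch_minimax X gamma k <= regret_minimax X gamma k)%E.
Proof.
move=> k0 X0 cX gn; apply: ge_ereal_sup => _ [d [S ->]].
apply: (@le_trans _ _ (@regret_minimax_on R n d S X gamma k)); last first.
  by apply: ereal_sup_ubound; exists d, S.
apply: le_ereal_inf_tmp => _ [xhat /= mx <-].
set rho := ereal_sup _.
have rhoP F (t : k.-tuple S) x : loss_class gamma F -> X x ->
    ((avg_regret xhat F t x)%:E <= rho)%E.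
  move=> lF Xx.
  apply: (@le_trans _ _ (ereal_sup [set (avg_regret xhat F t x)%:E | x in X])).
    by apply: ereal_sup_ubound; exists x.
  by apply: ereal_sup_ubound; exists (F, t).
apply: (@le_trans _ _ (ereal_sup [set ereal_sup
    [set stoch_risk X k (average_rule k xhat) F P | P in admissible_law F] | F in @loss_class R n d S gamma])).
  apply: ereal_inf_lbound; exists (average_rule k xhat) => //.
  exact: average_rule_measurable.
apply: ge_ereal_sup => _ [F lF <-]; apply: ge_ereal_sup => _ [P PF <-].
clearbody rho; case: rho rhoP => [rho||] rhoP.
- by apply: (stoch_risk_average_le k0 X0 cX gn mx lF PF) => t x Xx; rewrite -lee_fin rhoP.
- by rewrite leey.
- have [x Xx] := X0.
  by have := rhoP F [tuple point | i < k] x lF Xx; rewrite leeNy_eq.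
Qed.

End stochastic_vs_regret.
(** * Finite sample spaces *)

Section finite_integral.
Context {R : realType} {d : measure_display} {T : measurableType d}.
Variables (E : finType) (phi : E -> T).
Hypotheses (phi_inj : injective phi) (phi_surj : forall t, exists e, phi e = t).
Hypothesis phi_meas : forall e, measurable [set phi e].

Lemma finite_measurable (A : set T) : measurable A.
Proof.
have -> : A = \big[setU/set0]_(e <- enum E | `[< A (phi e) >]) [set phi e].
  apply/seteqP; split => t.
    have [e <-] := phi_surj t => Ae; rewrite -bigcup_seq_cond.
    by exists e => //=; rewrite mem_enum; exact/asboolP.
  by rewrite -bigcup_seq_cond => -[e /= /andP[_ /asboolP Ae] ->].
exact: bigsetU_measurable.
Qed.

Lemma finite_measurable_fun d' (T' : measurableType d') (D : set T) (f : T -> T') :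
  measurable_fun D f.
Proof. by move=> _ A _; exact: finite_measurable. Qed.

Lemma ge0_integral_finite (mu : {measure set T -> \bar R}) (f : T -> \bar R) :
  (forall t, 0 <= f t)%E ->
  (\int[mu]_t f t = \sum_(e : E) f (phi e) * mu [set phi e])%E.
Proof.
move=> f0.
have setTE : [set: T] = \big[setU/set0]_(e <- enum E) [set phi e].
  apply/seteqP; split => // t _; have [e <-] := phi_surj t.
  by rewrite -bigcup_seq; exists e => //=; rewrite mem_enum.
rewrite setTE ge0_integral_bigsetU//=; first last.
- exact: finite_measurable_fun.
- by move=> i j _ _ [t [/= -> /phi_inj]].
- exact: enum_uniq.
rewrite big_enum/=; apply: eq_bigr => e _.
rewrite -integral_cst//; apply: eq_integral => t.
by rewrite inE => ->.
Qed.

End finite_integral.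

Lemma finite_prob_exists {R : realType} {d : measure_display} {T : measurableType d}
    (E : finType) (phi : E -> T) (pm : E -> R) : injective phi ->
  (forall e, 0 <= pm e) -> \sum_e pm e = 1 ->
  exists P : probability T R, forall e, P [set phi e] = (pm e)%:E.
Proof.
move=> phi_inj pm0 pm1.
have [mu muE] : exists mu : {measure set T -> \bar R}, forall A,
    mu A = (\sum_e (pm e)%:E * \d_(phi e) A)%E.
  pose m (i : nat) : {measure set T -> \bar R} := if insub i is Some j
    then mscale (NngNum (pm0 (@enum_val E predT j))) \d_(phi (enum_val j)) else mzero.
  exists (msum m #|E|) => A; rewrite /msum [RHS](big_enum_val _)/=.
  by apply: eq_bigr => i _; rewrite /m valK.
have muT : mu setT = 1%E.
  rewrite muE; under eq_bigr do rewrite diracT mule1.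
  by rewrite sumEFin pm1.
(* [mu] has mass 1: normalising only turns it into a probability. *)
exists (mnormalize mu \d_point) => e.
rewrite /= /mnormalize muT onee_eq0/=.
rewrite invr1 mule1 muE (bigD1 e)//= diracE mem_set// mule1 big1 ?adde0// => i ie.
rewrite diracE memNset ?mule0// => /phi_inj ei.
by rewrite ei eqxx in ie.
Qed.

(** A sample is a coordinate with a sign.  [None] takes the mass that the
    coordinates leave over, and keeps the type inhabited for [n = 0]. *)
Definition coin (n : nat) : Type := option ('I_n * bool).

HB.instance Definition _ n := Finite.on (coin n).
HB.instance Definition _ n := isPointed.Build (coin n) None.
HB.instance Definition _ n := @isMeasurable.Build default_measure_display
  (coin n) discrete_measurable discrete_measurable0
  discrete_measurableC discrete_measurableU.

Lemma power_prob1 {R : realType} {d : measure_display} {S : measurableType d}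
    (P : probability S R) k (t : k.-tuple S) : (forall s : S, measurable [set s]) ->
  power_prob P k [set t] = (\prod_(i < k) P [set tnth t i])%E.
Proof.
move=> mS; rewrite -power_prob_box//; congr (power_prob P k _).
apply/seteqP; split => [_ ->//|u /= ut]; exact: eq_from_tnth.
Qed.

(** * Testing two nearby product distributions *)

Section two_point.
Context {R : realType}.

Lemma expR_mul_le1 n (x : R) : (0 < n)%N -> x <= n%:R ->
  expR x * (1 - x / n%:R) ^+ n <= 1.
Proof.
move=> n0 xn; have np : 0 < n%:R :> R by rewrite ltr0n.
have {1}-> : x = n%:R * (x / n%:R) by rewrite mulrC divfK ?gt_eqF.
rewrite expRM_natl -exprMn exprn_ile1 ?mulr_ge0 ?expR_ge0//.
  by rewrite subr_ge0 ler_pdivrMr// mul1r.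
have := ler_wpM2l (expR_ge0 (x / n%:R)) (expR_ge1Dx (- (x / n%:R))).
by rewrite expRN divff ?gt_eqF ?expR_gt0.
Qed.

Lemma sqr_step (u v w : R) m : 0 <= u -> w <= u * u -> u <= v ^+ m ->
  w <= v ^+ (m + m).
Proof. by move=> u0 wu uv; rewrite exprD (le_trans wu)// ler_pM. Qed.

(** Bounds [(1 - 43 / 1280) ^+ 32] from below by repeated squaring, with each
    fraction just below the square of the previous one. *)
Lemma ln3_ge : 43 / 40 <= ln 3 :> R.
Proof.
rewrite -ler_expR lnK ?posrE//.
have c32 : 43 / 40 <= 32%:R :> R by lra.
have := expR_mul_le1 (isT : (0 < 32)%N) c32.
set y := 1 - _; have yE : y = 1237 / 1280 by rewrite /y; lra.
have y1 : 1237 / 1280 <= y ^+ 1 by rewrite yE.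
have y2 : 127 / 136 <= y ^+ 2 by apply: sqr_step y1; lra.
have y4 : 34 / 39 <= y ^+ 4 by apply: sqr_step y2; lra.
have y8 : 19 / 25 <= y ^+ 8 by apply: sqr_step y4; lra.
have y16 : 41 / 71 <= y ^+ 16 by apply: sqr_step y8; lra.
have y32 : 1 / 3 <= y ^+ 32 by apply: sqr_step y16; lra.
have := ler_wpM2l (expR_ge0 (43 / 40)) y32; lra.
Qed.

Lemma bernoulli_ineq k (x : R) : 0 <= x -> x <= 1 -> 1 - k%:R * x <= (1 - x) ^+ k.
Proof.
move=> x0 x1; elim: k => [|k IH]; first by rewrite mul0r subr0 expr0.
have x10 : 0 <= 1 - x by lra.
rewrite exprS -natr1; have := ler_wpM2l x10 IH.
have : 0 <= k%:R * x * x by rewrite !mulr_ge0.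
lra.
Qed.

(** The left-hand side is about [4 * k * theta], and [1 / ln 3] is less than 1:
    the slack absorbs the higher-order terms of [(1 + theta) ^+ k], which are
    bounded through [expR (k * theta)]. *)
Lemma chi2_bound k (theta : R) : 0 <= theta -> k%:R * theta <= (4 * ln 3)^-1 ->
  2 * ((1 + theta) ^+ k - (1 - theta) ^+ k) <= 1.
Proof.
move=> t0; case: k => [|k]; first by rewrite !expr0; lra.
set a := _ * theta => a_le.
have {}a_le : a <= 10 / 43.
  rewrite (le_trans a_le)// invf_ple ?posrE//; have := ln3_ge; lra.
have t1 : theta <= 1.
  have : theta <= a by rewrite ler_peMl// ler1n.
  lra.
have a0 : 0 <= a by rewrite mulr_ge0.
have a8 : a <= 8%:R by lra.
have := expR_mul_le1 (isT : (0 < 8)%N) a8; set y := 1 - _ => ay.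
have y1 : 167 / 172 <= y by rewrite /y; lra.
have y2 : 82 / 87 <= y ^+ 2 by apply: (sqr_step (m := 1) _ _ y1); lra.
have y4 : 159 / 179 <= y ^+ 4 by apply: sqr_step y2; lra.
have y8 : 86 / 109 <= y ^+ 8 by apply: sqr_step y4; lra.
have yle : 1 <= y ^+ 8 * (3 / 2 - a).
  have : 1 <= (86 / 109) * (3 / 2 - a) by lra.
  by move=> /le_trans; apply; rewrite ler_wpM2r//; lra.
have y80 : 0 < y ^+ 8 by rewrite exprn_gt0//; lra.
have : expR a <= 3 / 2 - a.
  by rewrite -(ler_pM2l y80) (le_trans _ yle)// mulrC.
have : (1 + theta) ^+ k.+1 <= expR a.
  by rewrite expRM_natl lerXn2r ?nnegrE ?expR_ge0 ?expR_ge1Dx//; lra.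
have := bernoulli_ineq k.+1 t0 t1; rewrite -/a; lra.
Qed.

Lemma sum_tuple_prod (C : finType) (g : C -> R) k :
  \sum_(t : k.-tuple C) \prod_(i < k) g (tnth t i) = (\sum_c g c) ^+ k.
Proof.
rewrite -[in RHS](card_ord k) -prodr_const (bigA_distr_bigA (fun _ c => g c))/=.
rewrite (reindex (fun f : {ffun 'I_k -> C} => [tuple f i | i < k])).
  apply: eq_bigr => f _; apply: eq_bigr => i _; by rewrite tnth_mktuple.
exists (fun t : k.-tuple C => [ffun i => tnth t i]) => [f _|t _].
  by apply/ffunP => i; rewrite ffunE tnth_mktuple.
by apply: eq_from_tnth => i; rewrite tnth_mktuple ffunE.
Qed.

(** The chi-square method: both likelihoods are compared to the common base law
    [m], and the squared difference of the likelihood ratios is computed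
    coordinatewise. *)
Lemma two_point_test (C : finType) (m h : C -> R) k (theta : R)
    (A B : k.-tuple C -> bool) :
  (forall c, 0 <= m c) -> \sum_c m c = 1 -> \sum_c m c * h c = 0 ->
  (forall c, `|h c| <= 1) -> \sum_c m c * h c ^+ 2 = theta ->
  2 * ((1 + theta) ^+ k - (1 - theta) ^+ k) <= 1 ->
  (forall t, A t || B t) ->
  1 / 2 <=
    \sum_(t : k.-tuple C)
      (\prod_(i < k) (m (tnth t i) * (1 + h (tnth t i)))) * (A t)%:R +
    \sum_(t : k.-tuple C)
      (\prod_(i < k) (m (tnth t i) * (1 - h (tnth t i)))) * (B t)%:R.
Proof.
move=> m0 m1 mh h1 mh2 thk AB; rewrite -big_split/=.
pose M (t : k.-tuple C) := \prod_(i < k) m (tnth t i).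
pose p (t : k.-tuple C) := \prod_(i < k) (1 + h (tnth t i)).
pose q (t : k.-tuple C) := \prod_(i < k) (1 - h (tnth t i)).
have M0 t : 0 <= M t by apply: prodr_ge0.
have p0 t : 0 <= p t.
  by apply: prodr_ge0 => i _; have := h1 (tnth t i); rewrite ler_norml; lra.
have q0 t : 0 <= q t.
  by apply: prodr_ge0 => i _; have := h1 (tnth t i); rewrite ler_norml; lra.
have Mp : \sum_t M t * p t = 1.
  under eq_bigr do rewrite -big_split/=.
  rewrite (sum_tuple_prod (fun c => m c * (1 + h c))).
  by under eq_bigr do rewrite mulrDr mulr1; rewrite big_split/= m1 mh addr0 expr1n.
have Mq : \sum_t M t * q t = 1.
  under eq_bigr do rewrite -big_split/=.
  rewrite (sum_tuple_prod (fun c => m c * (1 - h c))).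
  by under eq_bigr do rewrite mulrBr mulr1; rewrite sumrB m1 mh subr0 expr1n.
have M1 : \sum_t M t = 1 by rewrite (sum_tuple_prod m) m1 expr1n.
have Mpp : \sum_t M t * p t ^+ 2 = (1 + theta) ^+ k.
  under eq_bigr do rewrite -prodrXl -big_split/=.
  rewrite (sum_tuple_prod (fun c => m c * (1 + h c) ^+ 2)); congr (_ ^+ k).
  rewrite (eq_bigr (fun c => m c + (2 * (m c * h c) + m c * h c ^+ 2))).
    2: by move=> c _; ring.
  by rewrite !big_split/= -mulr_sumr m1 mh mh2 mulr0 add0r.
have Mqq : \sum_t M t * q t ^+ 2 = (1 + theta) ^+ k.
  under eq_bigr do rewrite -prodrXl -big_split/=.
  rewrite (sum_tuple_prod (fun c => m c * (1 - h c) ^+ 2)); congr (_ ^+ k).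
  rewrite (eq_bigr (fun c => m c + (- 2 * (m c * h c) + m c * h c ^+ 2))).
    2: by move=> c _; ring.
  by rewrite !big_split/= -mulr_sumr m1 mh mh2 mulr0 add0r.
have Mpq : \sum_t M t * (p t * q t) = (1 - theta) ^+ k.
  under eq_bigr do rewrite -!big_split/=.
  rewrite (sum_tuple_prod (fun c => m c * ((1 + h c) * (1 - h c)))); congr (_ ^+ k).
  rewrite (eq_bigr (fun c => m c - m c * h c ^+ 2)); last by move=> c _; ring.
  by rewrite sumrB m1 mh2.
(* The right factor is at most [Num.min (p t) (q t)], because [|z|] is at most
   [(1 + z ^ 2) / 2] for [z = p t - q t]. *)
apply: (@le_trans _ _ (\sum_t M t * ((p t + q t) / 2 - (1 + (p t - q t) ^+ 2) / 4))).
  rewrite (eq_bigr (fun t => (M t * p t) / 2 + (M t * q t) / 2 - M t / 4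
     - (M t * p t ^+ 2) / 4 - (M t * q t ^+ 2) / 4 + (M t * (p t * q t)) / 2)); last first.
    by move=> t _; field.
  rewrite !big_split/= !sumrN -!mulr_suml Mp Mq M1 Mpp Mqq Mpq; lra.
apply: ler_sum => t _; rewrite !big_split/= -/(M t) -/(p t) -/(q t) -!mulrA -mulrDr.
apply: ler_wpM2l => //.
have := AB t; have := sqr_ge0 (p t - q t - 1); have := sqr_ge0 (p t - q t + 1).
have := p0 t; have := q0 t.
case: (A t); case: (B t) => //=; rewrite ?mulr1 ?mulr0; nra.
Qed.

End two_point.
(** * The hard instances *)

Section coin.
Context {R : realType} {n : nat}.

Lemma sum_coin (f : coin n -> R) :
  \sum_c f c = f None + \sum_j (f (Some (j, false)) + f (Some (j, true))).
Proof.
rewrite (bigD1 None)//=; congr (_ + _).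
rewrite (reindex_omap Some id) => [|[c|]//].
rewrite (eq_bigl xpredT) => [|c]; last by rewrite /= eqxx.
rewrite (eq_bigr (fun c => f (Some (c.1, c.2)))) => [|[]//].
rewrite -(pair_bigA _ (fun i b => f (Some (i, b))))/=.
by apply: eq_bigr => j _; rewrite big_bool addrC.
Qed.

Lemma coin_meas (c : coin n) : measurable [set c].
Proof. by []. Qed.

Lemma coin_tuple_meas k (t : k.-tuple (coin n)) : measurable [set t].
Proof.
rewrite [X in measurable X](_ : _ =
    \bigcap_(i in [set: 'I_k]) ((@tnth k (coin n))^~ i @^-1` [set tnth t i])).
  apply: fin_bigcap_measurable => // i _; rewrite -[X in measurable X]setTI.
  exact: measurable_tnth.
apply/seteqP; split => [_ -> //|u /= ut].
by apply: eq_from_tnth => i; exact: ut.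
Qed.

Implicit Types (p delta a : 'I_n -> R) (v : {ffun 'I_n -> bool}) (y : 'rV[R]_n).

(** The sign shown for [j] agrees with [v j] with probability
    [(1 + delta j) / 2]. *)
Definition coin_pm p delta v (c : coin n) : R :=
  if c is Some (j, b) then p j * (1 + (-1) ^+ (v j (+) b) * delta j) / 2
  else 1 - \sum_j p j.

Definition coin_loss (gamma : 'rV[R]_n -> R) a y (c : coin n) : R :=
  if c is Some (j, b) then `|y ord0 j - (-1) ^+ b * a j| / gamma (delta_mx ord0 j)
  else 0.

Lemma coin_pm_sum p delta v : \sum_c coin_pm p delta v c = 1.
Proof.
rewrite sum_coin /= -[RHS](subrK (\sum_j p j)); congr (_ + _).
by apply: eq_bigr => j _; case: (v j) => /=; rewrite ?expr0 ?expr1; lra.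
Qed.

Lemma coin_pm_ge0 p delta v c : (forall j, 0 <= p j) -> \sum_j p j <= 1 ->
  (forall j, 0 <= delta j <= 1) -> 0 <= coin_pm p delta v c.
Proof.
move=> p0 p1 d01; case: c => [[j b]|] /=; last by rewrite subr_ge0.
apply: divr_ge0 => //; apply: mulr_ge0 => //.
by have := d01 j; case: (_ (+) _); rewrite ?expr0 ?expr1; lra.
Qed.

Lemma coin_loss_ge0 gamma a y c : is_norm gamma -> 0 <= coin_loss gamma a y c.
Proof.
by move=> gn; case: c => [[j b]|]//=; rewrite divr_ge0// ltW// is_norm_delta_gt0.
Qed.

(** Each loss depends on one coordinate only, with slope [1 / gamma e_j]: its
    subgradients are multiples of [e_j] of norm at most 1. *)
Lemma coin_loss_in_class gamma a : is_norm gamma ->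
  @loss_class R n _ (coin n) gamma (coin_loss gamma a).
Proof.
move=> gn; split=> [c|y|y c g].
- apply/convex_functionP => y z s t s0 t0 st.
  case: c => [[j b]|] /=; last by rewrite !mulr0 addr0.
  rewrite !mulrA -mulrDl ler_wpM2r ?invr_ge0 ?is_norm_ge0// !mxE.
  set e := _ * a j.
  have -> : s * y ord0 j + t * z ord0 j - e = s * (y ord0 j - e) + t * (z ord0 j - e).
    by rewrite -[e in LHS]mul1r -st; ring.
  by rewrite (le_trans (ler_normD _ _))// !normrM (ger0_norm s0) (ger0_norm t0).
- by move=> _ A _.
move=> gsub.
(* The subgradient inequality along the axes. *)
have g_dir (r : R) i : r * g ord0 i <=
    coin_loss gamma a (y + r *: delta_mx ord0 i) c - coin_loss gamma a y c.
  rewrite lerBrDl (le_trans _ (gsub (y + r *: delta_mx ord0 i)))// lerD2l addrAC subrr add0r.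
  rewrite /dotv (bigD1 i)//= !mxE !eqxx/= mulr1 mulrC big1 ?addr0// => l li.
  by rewrite !mxE eqxx/= (negbTE li) !mulr0.
have [gN gZ _] := gn.
case: c gsub g_dir => [[j b]|] _ g_dir; last first.
  have -> : g = 0; last by rewrite (is_norm0 gn).
  apply/rowP => i; rewrite mxE; have := g_dir 1 i; have := g_dir (-1) i.
  by rewrite /=; lra.
have gj := is_norm_delta_gt0 gn j.
have -> : g = g ord0 j *: delta_mx ord0 j.
  apply/rowP => i; rewrite !mxE eqxx/=; have [->|ij] := eqVneq i j; first by rewrite mulr1.
  have := g_dir 1 i; have := g_dir (-1) i; rewrite /= !mxE eqxx/= eq_sym (negbTE ij).
  by rewrite !mulr0 !addr0; lra.
rewrite gZ -ler_pdivlMr// mul1r.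
have g_le (r : R) : r * g ord0 j <= `|r| / gamma (delta_mx ord0 j).
  rewrite (le_trans (g_dir r j))//= -mulrBl ler_wpM2r ?invr_ge0 ?(ltW gj)// !mxE !eqxx/= mulr1.
  by rewrite lerBlDl addrAC (le_trans (ler_normD _ _)).
by rewrite ler_norml; have := g_le 1; have := g_le (-1); rewrite normrN normr1; lra.
Qed.

Section prob.
Variables (gamma : 'rV[R]_n -> R) (a p delta : 'I_n -> R) (v : {ffun 'I_n -> bool}).
Variable P : probability (coin n) R.
Hypotheses (gn : is_norm gamma) (PE : forall c, P [set c] = (coin_pm p delta v c)%:E).

Let F := coin_loss gamma a.

Lemma coin_pop_loss y :
  pop_loss P F y = (\sum_c F y c * coin_pm p delta v c)%:E.
Proof.
rewrite /pop_loss (@ge0_integral_finite R _ (coin n) (coin n) id)//.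
- by rewrite -sumEFin; apply: eq_bigr => c _; rewrite EFinM -PE.
- by move=> c; exists c.
- by move=> c; rewrite lee_fin coin_loss_ge0.
Qed.

Lemma coin_admissible : admissible_law F P.
Proof.
move=> y; apply/integrableP; split.
  by apply/measurable_EFinP; case: (coin_loss_in_class a gn).
rewrite (eq_integral (fun c => (F y c)%:E)) => [|c _]; last first.
  by rewrite /= ger0_norm// coin_loss_ge0.
by rewrite -[X in (X < _)%E]/(pop_loss P F y) coin_pop_loss ltry.
Qed.

End prob.

End coin.
Section hard_instance.
Context {R : realType} {n : nat}.
Implicit Types (y : 'rV[R]_n) (v : {ffun 'I_n -> bool}).
Variables (gamma : 'rV[R]_n -> R) (a p delta : 'I_n -> R).
Hypotheses (gn : is_norm gamma) (a0 : forall j, 0 <= a j).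
Hypotheses (p0 : forall j, 0 <= p j) (p1 : \sum_j p j <= 1).
Hypothesis d01 : forall j, 0 <= delta j <= 1.

Let F := coin_loss gamma a.
Let weight j := p j * delta j * (a j / gamma (delta_mx ord0 j)).

Definition corner v : 'rV[R]_n := \row_j ((-1) ^+ v j * a j).

Definition wrong_sign v y j : bool := (-1) ^+ v j * y ord0 j <= 0.

Lemma weight_ge0 j : 0 <= weight j.
Proof.
rewrite mulr_ge0 ?divr_ge0 ?is_norm_ge0// mulr_ge0//.
by have /andP[] := d01 j.
Qed.

(** The excess expected distance to a random sign of bias [e] towards 1, scaled
    by [b], over the point [b] itself; the triangle inequality
    [2 * b <= |u - b| + |u + b|] reduces it to [e * |u - b|]. *)
Lemma sign_excess (u b e : R) : 0 <= b -> 0 <= e -> e <= 1 ->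
  e * b * (u <= 0)%R%:R <=
  `|u - b| * ((1 + e) / 2) + (`|u + b| - 2 * b) * ((1 - e) / 2).
Proof.
move=> b0 e0 e1.
have N1 : u - b <= `|u - b| by rewrite ler_norm.
have N2 : b - u <= `|u - b| by rewrite distrC ler_norm.
have N3 : u + b <= `|u + b| by rewrite ler_norm.
have : 0 <= (1 - e) * (`|u + b| - 2 * b + `|u - b|) by apply: mulr_ge0; lra.
have [u0|u0] := leP u 0; rewrite /= ?mulr1 ?mulr0.
  by have : 0 <= e * (`|u - b| - b) by [apply: mulr_ge0; lra]; lra.
by have : 0 <= e * `|u - b| by [apply: mulr_ge0]; lra.
Qed.

Lemma coin_gap v y :
  \sum_j weight j * (wrong_sign v y j)%:R <=
  \sum_c F y c * coin_pm p delta v c - \sum_c F (corner v) c * coin_pm p delta v c.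
Proof.
rewrite -sumrB sum_coin /= !mul0r subrr add0r; apply: ler_sum => j _.
have gj := is_norm_delta_gt0 gn j; rewrite /F /= /weight /wrong_sign !mxE !expr0 !expr1 !mul1r.
set g := gamma _ in gj *; set u := y _ _; have /andP[d0 d1] := d01 j.
have pg : 0 <= p j / g by rewrite divr_ge0// ltW.
case: (v j) => /=; rewrite ?expr0 ?expr1.
- have := ler_wpM2l pg (sign_excess (- u) (a0 j) d0 d1).
  rewrite !mulN1r opprK -opprD normrN distrC -[- u + a j]addrC.
  have -> : `|- a j - a j| = 2 * a j by rewrite -opprD normrN ger0_norm ?addr_ge0//; lra.
  rewrite addNr normr0; lra.
- have := ler_wpM2l pg (sign_excess u (a0 j) d0 d1).
  rewrite !mul1r !mulN1r !opprK subrr normr0.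
  have -> : `|a j + a j| = 2 * a j by rewrite ger0_norm ?addr_ge0//; lra.
  lra.
Qed.

Lemma stoch_risk_coin_ge (X : set 'rV[R]_n) k (xhat : @rule R n) v
    (P : probability (coin n) R) : X (corner v) ->
  (forall c, P [set c] = (coin_pm p delta v c)%:E) ->
  ((\sum_(t : k.-tuple (coin n)) (\sum_j weight j *
      (wrong_sign v (xhat (observe F t)) j)%:R) *
      \prod_(i < k) coin_pm p delta v (tnth t i))%:E <= stoch_risk X k xhat F P)%E.
Proof.
move=> Xv PE.
pose psi (t : k.-tuple (coin n)) := \sum_j weight j *
      (wrong_sign v (xhat (observe F t)) j)%:R.
have psi0 t : 0 <= psi t.
  by apply: sumr_ge0 => j _; rewrite mulr_ge0 ?weight_ge0.
have tsurj (t : k.-tuple (coin n)) : exists u, id u = t by exists t.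
have mfin := finite_measurable_fun tsurj (@coin_tuple_meas n k).
apply: (@le_trans _ _ (\int[power_prob P k]_t (psi t)%:E)%E).
  rewrite (@ge0_integral_finite R _ _ (k.-tuple (coin n)) id (fun _ _ => id)
    tsurj (@coin_tuple_meas n k)) => [|t]; last by rewrite lee_fin.
  rewrite -sumEFin le_eqVlt; apply/orP; left; apply/eqP.
  apply: eq_bigr => t _; rewrite EFinM -prodEFin; congr (_ * _)%E.
  apply: etrans (esym (power_prob1 P t (@coin_meas n))).
  by apply: eq_bigr => i _; rewrite PE.
apply: ge0_le_integral => //.
- by move=> t _; rewrite lee_fin psi0.
- exact: mfin.
- exact: mfin.
move=> t _.
apply: (@le_trans _ _ (pop_loss P F (xhat (observe F t)) - pop_loss P F (corner v))%E).
  by rewrite !(coin_pop_loss a gn PE) -EFinB lee_fin coin_gap.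
by apply: leeB => //; apply: ereal_inf_lbound; exists (corner v).
Qed.

Definition flip_coord j v : {ffun 'I_n -> bool} := [ffun i => (i == j) (+) v i].

Definition test_error k (xhat : @rule R n) v j : R :=
  \sum_(t : k.-tuple (coin n)) (\prod_(i < k) coin_pm p delta v (tnth t i)) *
    (wrong_sign v (xhat (observe F t)) j)%:R.

(** The two laws are [1 + h] and [1 - h] times the law [m] in which the signs of
    coordinate [j] are unbiased. *)
Lemma test_error_flip k xhat v j : k%:R * (p j * delta j ^+ 2) <= (4 * ln 3)^-1 ->
  1 / 2 <= test_error k xhat v j + test_error k xhat (flip_coord j v) j.
Proof.
move=> kpd; pose delta' i := if i == j then 0 else delta i.
pose m := coin_pm p delta' v.
pose h (c : coin n) : R := if c is Some (i, b) then
  (i == j)%:R * ((-1) ^+ (v j (+) b) * delta j) else 0.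
have d'01 i : 0 <= delta' i <= 1 by rewrite /delta'; case: ifP; rewrite ?lexx ?ler01.
have E1 c : coin_pm p delta v c = m c * (1 + h c).
  case: c => [[i b]|] /=; last by rewrite /m /= addr0 mulr1.
  rewrite /m /= /delta'; have [->|ij] := eqVneq i j; first by rewrite mul1r; field.
  by rewrite mul0r addr0 mulr1.
have E2 c : coin_pm p delta (flip_coord j v) c = m c * (1 - h c).
  case: c => [[i b]|] /=; last by rewrite /m /= subr0 mulr1.
  rewrite /m /= ffunE /delta'; have [->|ij] := eqVneq i j.
    by rewrite mul1r /= addNb; case: (_ (+) _); rewrite /= ?expr0 ?expr1; field.
  by rewrite mul0r subr0 mulr1.
have := @two_point_test R (coin n) m h k (p j * delta j ^+ 2)
  (fun t => wrong_sign v (xhat (observe F t)) j)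
  (fun t => wrong_sign (flip_coord j v) (xhat (observe F t)) j).
rewrite /test_error.
under [X in _ -> _ <= X + _]eq_bigr do under eq_bigr do rewrite E1.
under [X in _ -> _ <= _ + X]eq_bigr do under eq_bigr do rewrite E2.
apply.
- by move=> c; exact: coin_pm_ge0.
- exact: coin_pm_sum.
- rewrite sum_coin /= mulr0 add0r big1 // => i _; rewrite /m /= /delta'.
  have [->|ij] := eqVneq i j; last by rewrite !mul0r !mulr0 addr0.
  by case: (v j); rewrite /= ?expr0 ?expr1; field.
- case=> [[i b]|] /=; last by rewrite normr0.
  have /andP[d0 d1] := d01 j; rewrite !normrM normrX normrN1 expr1n mul1r (ger0_norm d0).
  by case: eqP => _; rewrite ?normr1 ?normr0 ?mul1r ?mul0r.
- rewrite sum_coin /= expr0n mulr0 add0r (bigD1 j)//= big1 => [|i ij]; last first.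
    by rewrite (negbTE ij) !mul0r expr0n !mulr0 addr0.
  by rewrite /m /= /delta' eqxx; case: (v j); rewrite /= ?expr0 ?expr1; field.
- by apply: chi2_bound => //; rewrite mulr_ge0// sqr_ge0.
- move=> t; rewrite /wrong_sign ffunE eqxx /=.
  by case: (v j); rewrite /= expr0 expr1 mul1r mulN1r oppr_le0 le_total.
Qed.

(** Averaging over all sign patterns, each coordinate is misjudged with
    probability at least 1/4; some pattern is at least as bad as the average. *)
Lemma exists_hard_signs k xhat :
  (forall j, k%:R * (p j * delta j ^+ 2) <= (4 * ln 3)^-1) ->
  exists v, 1 / 4 * \sum_j weight j <= \sum_j weight j * test_error k xhat v j.
Proof.
move=> kpd; apply/not_existsP => noV.
have lt v : \sum_j weight j * test_error k xhat v j < 1 / 4 * \sum_j weight j.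
  by rewrite ltNge; apply/negP/noV.
have avg j : \sum_(v : {ffun 'I_n -> bool}) (1 / 4) <= \sum_v test_error k xhat v j.
  have flipK : involutive (flip_coord j).
    by move=> v; apply/ffunP => i; rewrite !ffunE addbA addbb addFb.
  have E : \sum_v test_error k xhat (flip_coord j v) j = \sum_v test_error k xhat v j.
    by rewrite [RHS](reindex_inj (inv_inj flipK)).
  have : \sum_(v : {ffun 'I_n -> bool}) (1 / 2 : R) <=
      \sum_v test_error k xhat v j + \sum_v test_error k xhat v j.
    by rewrite -{2}E -big_split; apply: ler_sum => v _; exact: test_error_flip.
  have -> : \sum_(v : {ffun 'I_n -> bool}) (1 / 2 : R) =
      \sum_(v : {ffun 'I_n -> bool}) (1 / 4) + \sum_(v : {ffun 'I_n -> bool}) (1 / 4).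
    by rewrite -big_split/=; apply: eq_bigr => v _; lra.
  lra.
have : \sum_(v : {ffun 'I_n -> bool}) \sum_j weight j * test_error k xhat v j <
       \sum_(v : {ffun 'I_n -> bool}) (1 / 4 * \sum_j weight j).
  by apply: ltr_sum => //; apply/hasP; exists [ffun=> true]; rewrite ?mem_index_enum.
rewrite ltNge => /negP; apply.
rewrite [leRHS]exchange_big/= -mulr_suml mulr_sumr; apply: ler_sum => j _.
by rewrite -[leRHS]mulr_sumr mulrC ler_wpM2l ?weight_ge0.
Qed.

Lemma stoch_minimax_coin_ge (X : set 'rV[R]_n) k :
  (forall v, X (corner v)) ->
  (forall j, k%:R * (p j * delta j ^+ 2) <= (4 * ln 3)^-1) ->
  ((1 / 4 * \sum_j weight j)%:E <= stoch_minimax X gamma k)%E.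
Proof.
move=> Xc kpd.
apply: (@le_trans _ _ (@stoch_minimax_on R n _ (coin n) X gamma k)); last first.
  by apply: ereal_sup_ubound; exists default_measure_display, (coin n).
apply: le_ereal_inf_tmp => _ [xhat _ <-].
have [v hv] := exists_hard_signs xhat kpd.
have [P PE] := @finite_prob_exists R _ (coin n) (coin n) id (coin_pm p delta v)
   (fun _ _ => id) (fun c => coin_pm_ge0 v c p0 p1 d01) (coin_pm_sum p delta v).
apply: (@le_trans _ _ (stoch_risk X k xhat F P)); last first.
  apply: (@le_trans _ _ (ereal_sup [set stoch_risk X k xhat F P | P in admissible_law F])).
    by apply: ereal_sup_ubound; exists P => //; exact: coin_admissible PE.
  by apply: ereal_sup_ubound; exists F => //; exact: coin_loss_in_class.
apply: le_trans (stoch_risk_coin_ge k xhat (Xc v) PE); rewrite lee_fin (le_trans hv)//.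
rewrite le_eqVlt; apply/orP; left; apply/eqP.
under [RHS]eq_bigr do rewrite mulr_suml.
rewrite exchange_big/=; apply: eq_bigr => j _; rewrite mulr_sumr.
by apply: eq_bigr => t _; rewrite [X in _ * X]mulrC mulrA.
Qed.

End hard_instance.
(** * The lower bound *)

Section lower_bound.
Context {R : realType} {n : nat}.
Implicit Types (X : set 'rV[R]_n) (x : 'rV[R]_n).
Variables (gamma : 'rV[R]_n -> R) (k d : nat).
Hypotheses (gn : is_norm gamma) (k0 : (0 < k)%N).

Let kL : R := k%:R * ln 3.

Let kL0 : 0 < kL.
Proof.
rewrite mulr_gt0// ?ltr0n//; apply: lt_le_trans ln3_ge.
by rewrite divr_gt0.
Qed.

Lemma orthosymmetric_corner X x v : orthosymmetric X -> X x ->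
  X (corner (fun j => `|x ord0 j|) v).
Proof.
move=> oX Xx; rewrite (_ : corner _ v = flip (fun j => v j (+) (x ord0 j < 0)) x).
  exact: oX.
apply/rowP => j; rewrite !mxE signr_addb -mulrA; congr (_ * _).
by rewrite normrEsign.
Qed.

(** The instance whose samples never show a coordinate has only zero losses. *)
Lemma stoch_minimax_ge0 X : X !=set0 -> orthosymmetric X ->
  (0 <= stoch_minimax X gamma k)%E.
Proof.
move=> [x Xx] oX.
apply: le_trans (@stoch_minimax_coin_ge R n gamma (fun j => `|x ord0 j|)
  (fun=> 0) (fun=> 0) gn _ _ _ _ X k (fun v => orthosymmetric_corner v oX Xx) _) => //.
- by rewrite lee_fin mulr_ge0// sumr_ge0// => j _; rewrite !mul0r.
- by rewrite big1.
- by move=> j; rewrite lexx ler01.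
- move=> j; rewrite mul0r mulr0 invr_ge0 mulr_ge0//.
  by rewrite ltW// (lt_le_trans _ ln3_ge)// divr_gt0.
Qed.

(** The bias is the largest one for which the signs stay indistinguishable.  The
    coordinates with [kL * p j < 1], where the formula may exceed the maximal
    bias 1, get bias 0; there are at most [d] of them in the support of [x],
    which costs at most [d / kL] of the total mass of [p]. *)
Lemma stoch_minimax_ge_res X x : orthosymmetric X -> X x -> (l0norm x <= d)%N ->
  (((8 * Num.sqrt kL)^-1 * (1 - d%:R / kL) * l2norm (res x gamma))%:E <=
   stoch_minimax X gamma k)%E.
Proof.
move=> oX Xx xd; set N := l2norm _.
have [N0|N0] := eqVneq N 0.
  by rewrite N0 mulr0; apply: stoch_minimax_ge0 => //; exists x.
have Np : 0 < N by rewrite lt_neqAle eq_sym N0 sqrtr_ge0.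
pose r j := `|x ord0 j| / gamma (delta_mx ord0 j).
have r0 j : 0 <= r j by rewrite divr_ge0// is_norm_ge0.
have sumr2 : \sum_j r j ^+ 2 = N ^+ 2.
  rewrite sqr_sqrtr ?sumr_ge0// => [|j _]; last exact: sqr_ge0.
  by apply: eq_bigr => j _; rewrite !mxE !exprMn real_normK ?num_real.
pose q j := r j / N; pose p j := q j ^+ 2.
have q0 j : 0 <= q j by rewrite divr_ge0// ltW.
have sump : \sum_j p j = 1.
  rewrite /p /q; under eq_bigr do rewrite exprMn.
  by rewrite -mulr_suml sumr2 exprVn divff// expf_neq0.
pose s := Num.sqrt kL; have s0 : 0 < s by rewrite sqrtr_gt0.
have s2 : s ^+ 2 = kL by rewrite sqr_sqrtr// ltW.
pose good j := 1 <= kL * p j.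
have goodq j : good j -> 1 <= s * q j.
  by rewrite /good /p -s2 -exprMn expr_ge1// mulr_ge0// ltW.
pose delta j := if good j then (2 * (s * q j))^-1 else 0.
have wE j : p j * delta j * r j = if good j then N / (2 * s) * p j else 0.
  rewrite /delta; case: ifP => [/goodq gj|_]; last by rewrite mulr0 mul0r.
  have qj : q j != 0 by apply/eqP => q00; move: gj; rewrite q00 mulr0 ler10.
  have -> : r j = q j * N by rewrite /q divfK.
  by rewrite /p; field; rewrite qj gt_eqF.
have bad : \sum_(j | ~~ good j) p j <= d%:R / kL.
  apply: (@le_trans _ _ (\sum_(j | x ord0 j != 0) kL^-1)).
    rewrite [leLHS]big_mkcond [leRHS]big_mkcond/=; apply: ler_sum => j _.
    have [xj|xj] := eqVneq (x ord0 j) 0.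
      by case: ifP => // _; rewrite /p /q /r xj normr0 !mul0r expr0n.
    case: ifP => [|_]; last by rewrite invr_ge0 ltW.
    rewrite /good -ltNge => pj; rewrite -[leRHS]mul1r ler_pdivlMr// mulrC; exact: ltW.
  rewrite sumr_const -[_ *+ _]mulr_natl ler_pM2r ?invr_gt0// ler_nat.
  exact: xd.
have := @stoch_minimax_coin_ge R n gamma (fun j => `|x ord0 j|) p delta gn
  _ _ _ _ X k (fun v => orthosymmetric_corner v oX Xx).
move=> H; apply: le_trans (H _ _ _ _ _) => //.
- rewrite lee_fin (eq_bigr _ (fun j _ => wE j)) -big_mkcond/= -mulr_sumr.
  have -> : \sum_(j | good j) p j = 1 - \sum_(j | ~~ good j) p j.
    by have := sump; rewrite (bigID good)/=; lra.
  have Ns : 0 <= N / (8 * s) by rewrite divr_ge0 ?mulr_ge0// ltW.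
  have := ler_wpM2l Ns bad; rewrite -/s.
  have -> : (8 * s)^-1 * (1 - d%:R / kL) * N = N / (8 * s) * (1 - d%:R / kL).
    by rewrite mulrC mulrA.
  have -> : 1 / 4 * (N / (2 * s) * (1 - \sum_(j | ~~ good j) p j)) =
      N / (8 * s) * (1 - \sum_(j | ~~ good j) p j) by field; rewrite gt_eqF.
  by rewrite !mulrBr; lra.
- by move=> j; exact: sqr_ge0.
- by rewrite sump.
- move=> j; rewrite /delta; case: ifP => [/goodq gj|_]; last by rewrite lexx ler01.
  rewrite invr_ge0 invf_le1; lra.
- move=> j; rewrite /delta; case: ifP => [/goodq gj|_]; last first.
    by rewrite expr0n !mulr0 invr_ge0 mulr_ge0// ltW// (lt_le_trans _ ln3_ge)// divr_gt0.
  have qj : q j != 0 by apply/eqP => q00; move: gj; rewrite q00 mulr0 ler10.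
  have ln0 : ln 3 != 0 :> R by rewrite gt_eqF// (lt_le_trans _ ln3_ge)// divr_gt0.
  have kn0 : k%:R != 0 :> R by rewrite pnatr_eq0 -lt0n.
  have -> : p j * (2 * (s * q j))^-1 ^+ 2 = (4 * s ^+ 2)^-1.
    by rewrite /p; field; rewrite qj gt_eqF.
  rewrite s2 /kL le_eqVlt; apply/orP; left; apply/eqP; field.
  by rewrite ln0 kn0.
Qed.

Lemma stoch_minimax_lower X : X !=set0 -> orthosymmetric X ->
  convex_set (X : set (convex_lmodType 'rV[R]_n)) ->
  ((1 / (8 * Num.sqrt (k%:R * ln 3)) * (1 - d%:R / (k%:R * ln 3)))%:E *
         ereal_sup [set (l2norm (res x gamma))%:E
                   | x in [set x | X x /\ (l0norm x <= d)%N]]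
       <= stoch_minimax X gamma k)%E.
Proof.
move=> X0 oX cX; rewrite div1r -/kL; set c := _ * _; set E := ereal_sup _.
have E0 : (0 <= E)%E.
  have [x Xx] := X0.
  have X00 : X 0.
    have h0 : 0 <= 2^-1 :> R by rewrite invr_ge0.
    have h1 : 2^-1 <= 1 :> R by rewrite invf_le1 ?ler1n.
    have := convex_set_segment cX Xx (oX x (fun=> true) Xx) h0 h1.
    congr X; apply/rowP => j; rewrite !mxE expr1; lra.
  apply: (@le_trans _ _ (l2norm (res 0 gamma))%:E); first by rewrite lee_fin sqrtr_ge0.
  apply: ereal_sup_ubound; exists 0 => //; split => //.
  by rewrite /l0norm eq_card0// => j; rewrite !inE mxE eqxx.
have [c0|c0] := leP c 0.
  apply: (@le_trans _ _ 0%E); last exact: stoch_minimax_ge0.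
  by rewrite mule_le0_ge0// lee_fin.
rewrite -lee_pdivlMl//; apply: ge_ereal_sup => _ [x [Xx xd] <-].
by rewrite lee_pdivlMl// -EFinM; exact: stoch_minimax_ge_res.
Qed.

End lower_bound.

Theorem theorem2 (R : realType) (n : nat) (X : set 'rV[R]_n)
    (gamma : 'rV[R]_n -> R) (d k : nat)
    (X_nonempty : X !=set0)
    (X_orthosymmetric : orthosymmetric X)
    (X_qconvex : quadratically_convex X)
    (X_convex : convex_set (X : set (convex_lmodType 'rV[R]_n)))
    (X_compact : compact X)
    (gamma_norm : is_norm gamma)
    (k_ge1 : (1 <= k)%N) :
  [/\ ((1 / (8 * Num.sqrt (k%:R * ln 3)) * (1 - d%:R / (k%:R * ln 3)))%:E *
         ereal_sup [set (l2norm (res x gamma))%:E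
                   | x in [set x | X x /\ (l0norm x <= d)%N]]
       <= stoch_minimax X gamma k)%E,
      (stoch_minimax X gamma k <= regret_minimax X gamma k)%E
    & (regret_minimax X gamma k <=
         (1 / Num.sqrt k%:R)%:E *
         ereal_sup [set ereal_sup [set (dotv x g)%:E
                                  | g in QHull (unit_ball gamma)]
                   | x in X])%E].
Proof.
split.
- exact: stoch_minimax_lower.
- exact: stoch_minimax_le_regret.
- exact: regret_minimax_upper.
Qed.
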